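(* In the physical variables $(u,\overline u)$, the reduced Hamiltonian $\mathcal{H}=\mathcal{H}^{(2)}+\mathcal{H}^{(4)}_+$ reads $$\begin{aligned}\mathcal{H}={}&\varepsilon\int\overline u\,\Omega(k_0+\varepsilon D_X)u\,dX+\varepsilon^3\,\frac{k_0^3(\omega_0-\gamma)(\gamma^2+4\omega_0^2)}{4\omega_0\Omega_0(2\omega_0-\gamma)}\int|u|^4\,dX\\ &+\varepsilon^4\,\frac{\beta}{2}\int|u|^2\,\mathrm{Im}(\overline u\,\partial_Xu)\,dX-\varepsilon^4\,\frac{k_0^2\omega_0^2}{2\Omega_0^2}\int|u|^2\,|D_X|\,|u|^2\,dX+O(\varepsilon^5),\end{aligned}$$ where $D_X=-i\partial_X$ in the slow spatial variable $X$.
   Context: Fix $g>0$, $\gamma\in\mathbb{R}$ (constant vorticity), a carrier wavenumber $k_0>0$ and a small parameter $\varepsilon>0$. Let $\omega_k=\sqrt{\gamma^2/4+g|k|}$ and $\Omega(k)=\Omega_k=\frac{\gamma}{2}\mathrm{sgn}(k)+\omega_k$. In coefficients, $\omega_0,\Omega_0$ denote the values $\omega_{k_0},\Omega_{k_0}$ at the carrier wavenumber, and $\omega_{2k_0}=\sqrt{\gamma^2/4+2gk_0}$, $\Omega_{\pm2k_0}=\pm\frac{\gamma}{2}+\omega_{2k_0}$. Modulational Ansatz: $k=k_0+\varepsilon\lambda$ and $U(\lambda)=z(k_0+\varepsilon\lambda)$, where $z$ is the complex symplectic coordinate in Fourier space; $u(X)=\frac{1}{\sqrt{2\pi}}\int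 e^{i\lambda X}U(\lambda)\,d\lambda$ with $X=\varepsilon x$ (so $z(x)=\varepsilon u(X)e^{ik_0x}$). $|D_X|$ and $\Omega(k_0+\varepsilon D_X)$ are the Fourier multipliers with symbols $|\lambda|$ and $\Omega(k_0+\varepsilon\lambda)$. $U_j=U(\lambda_j)$, $\delta_{1+2-3-4}=\delta(\lambda_1+\lambda_2-\lambda_3-\lambda_4)$. The quadratic part is $\mathcal{H}^{(2)}=\int\Omega_k|z_k|^2\,dk$. In the modulational regime, the quartic part obtained after the third-order normal form transformation is $$\begin{aligned}\mathcal{H}^{(4)}_+={}&\varepsilon^3\frac{k_0^3(\omega_0-\gamma)(\gamma^2+4\omega_0^2)}{8\pi\omega_0\Omega_0(2\omega_0-\gamma)}\int U_1U_2\overline U_3\overline U_4\,\delta_{1+2-3-4}\,d\lambda_{1234}\\ &+\varepsilon^4\int\Big(\frac{\beta}{8\pi}(\lambda_2+\lambda_3)-\frac{k_0^2\omega_0^2}{4\pi\Omega_0^2}|\lambda_1-\lambda_3|\Big)U_1U_2\overline U_3\overline U_4\,\delta_{1+2-3-4}\,d\lambda_{1234}+O(\varepsilon^5),\end{aligned}$$ where $\beta=8\pi\big[c_0^r-\frac12(c_1^r+c_2^r+c_3^{r,1})\big]$ with $$c_0^r=\frac{3k_0^2\Omega_0^2}{16\pi\omega_0^2}-\frac{\gamma gk_0^3\Omega_0}{32\pi\omega_0^4},$$ $$c_1^r=g\,c_1^l\Big(\frac{2\Omega_{2k_0}}{\omega_{2k_0}(2\omega_0^2+\gamma\omega_{2k_0})}-\frac{1}{2\omega_0^2}-\frac{1}{2\omega_{2k_0}^2}+\frac{3}{2gk_0}-\frac{\omega_{2k_0}+\omega_0}{2\omega_{2k_0}\omega_0(2\Omega_0+\Omega_{-2k_0})}\Big),\quad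 c_1^l=\frac{k_0^3(2\omega_0^2+\gamma\omega_{2k_0})^2}{16\pi\omega_0^2\omega_{2k_0}(2\Omega_0+\Omega_{-2k_0})},$$ $$c_2^r=g\,c_2^l\Big(\frac{2\Omega_{-2k_0}}{\omega_{2k_0}(2\omega_0^2-\gamma\omega_{2k_0})}-\frac{1}{2\omega_0^2}-\frac{1}{2\omega_{2k_0}^2}+\frac{3}{2gk_0}-\frac{\omega_{2k_0}-\omega_0}{2\omega_{2k_0}\omega_0(2\Omega_0-\Omega_{2k_0})}\Big),\quad c_2^l=-\frac{k_0^3(2\omega_0^2-\gamma\omega_{2k_0})^2}{16\pi\omega_0^2\omega_{2k_0}(2\Omega_0-\Omega_{2k_0})},$$ $$c_3^{r,1}=c_3^l\Big(\frac{1}{k_0}+\frac{g\gamma}{8\Omega_0\omega_0^2}\Big),\quad c_3^l=\frac{\gamma^2k_0^2\omega_0}{2\pi g\Omega_0}.$$ *)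

(* Defs.v *)
From HB Require Import structures.
From mathcomp Require Import all_boot all_order all_algebra.
From mathcomp Require Import all_classical all_reals all_analysis.
From mathcomp Require Export complex.
Import Order.TTheory GRing.Theory Num.Theory numFieldNormedType.Exports.

Set Implicit Arguments.
Unset Strict Implicit.
Unset Printing Implicit Defensive.

Local Open Scope classical_set_scope.
Local Open Scope ring_scope.
Local Open Scope complex_scope.

(* All integrals over the real line are Lebesgue integrals; complex-valued
   functions are integrated and differentiated componentwise. *)
Section ComplexCalculus.
Context {R : realType}.
Implicit Types (f : R -> R[i]) (m : R -> R).

Definition rint (f : R -> R) : R := Rintegral (@lebesgue_measure R) setT f.

Definition cint f : R[i] :=
  rint (fun x => complex.Re (f x)) +i* rint (fun x => complex.Im (f x)).

Definition cintegrable f : Prop :=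
  (@lebesgue_measure R).-integrable setT (fun x => (complex.Re (f x))%:E) /\
  (@lebesgue_measure R).-integrable setT (fun x => (complex.Im (f x))%:E).

Definition ccontinuous f : Prop :=
  continuous (fun x => complex.Re (f x)) /\ continuous (fun x => complex.Im (f x)).

Definition cderive f (x : R) : R[i] :=
  derive1 (fun y => complex.Re (f y)) x +i* derive1 (fun y => complex.Im (f y)) x.

Definition cabs (z : R[i]) : R := Normc.normc z.

Definition cis (t : R) : R[i] := cos t +i* sin t.

Definition fourier f (l : R) : R[i] :=
  ((Num.sqrt (2 * pi))^-1)%:C * cint (fun x => cis (- (l * x)) * f x).

Definition ifourier f (x : R) : R[i] :=
  ((Num.sqrt (2 * pi))^-1)%:C * cint (fun l => cis (l * x) * f l).

(* m(D) with D = -i d/dx. *)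
Definition multiplier m f : R -> R[i] :=
  ifourier (fun l => (m l)%:C * fourier f l).

(* \int K(l1,l2,l3) U1 U2 conj(U3) conj(U4) delta(l1+l2-l3-l4) dl1 dl2 dl3 dl4,
   the delta function being resolved as l4 = l1 + l2 - l3. *)
Definition quartic_int (K : R -> R -> R -> R) (U : R -> R[i]) : R[i] :=
  cint (fun l1 => cint (fun l2 => cint (fun l3 =>
    (K l1 l2 l3)%:C * (U l1 * U l2 * (U l3)^*%C * (U (l1 + l2 - l3))^*%C)))).

(* Regularity class making every integral absolutely convergent; it contains
   all Schwartz functions. *)
Definition regular_profile (U : R -> R[i]) : Prop :=
  [/\ ccontinuous U,
      cintegrable (fun l => (1 + `|l|)%:C * U l) &
      cintegrable (ifourier U)].

(* F(eps) = O(eps^5) as eps -> 0+. *)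
Definition is_O5 (F : R -> R[i]) : Prop :=
  exists C : R, \forall eps \near (0 : R)^'+, cabs (F eps) <= C * eps ^+ 5.

End ComplexCalculus.

Section WaterWaves.
Context {R : realType}.
Variables (g gamma : R).

Definition omega (k : R) : R := Num.sqrt (gamma ^+ 2 / 4 + g * `|k|).

Definition Omega (k : R) : R := gamma / 2 * Num.sg k + omega k.

Definition H2 (z : R -> R[i]) : R := rint (fun k => Omega k * cabs (z k) ^+ 2).

Definition reduced_H (H4 : (R -> R[i]) -> R) (z : R -> R[i]) : R := H2 z + H4 z.

Variable k0 : R.

(* The z with z (k0 + eps l) = U l. *)
Definition modulated (eps : R) (U : R -> R[i]) (k : R) : R[i] :=
  U ((k - k0) / eps).

Let o0 := omega k0.
Let O0 := Omega k0.
Let o2 := omega (2 * k0).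
Let O2p := Omega (2 * k0).
Let O2m := Omega (- (2 * k0)).

Definition c0r : R :=
  3 * k0 ^+ 2 * O0 ^+ 2 / (16 * pi * o0 ^+ 2)
  - gamma * g * k0 ^+ 3 * O0 / (32 * pi * o0 ^+ 4).

Definition c1l : R :=
  k0 ^+ 3 * (2 * o0 ^+ 2 + gamma * o2) ^+ 2
  / (16 * pi * o0 ^+ 2 * o2 * (2 * O0 + O2m)).

Definition c1r : R :=
  g * c1l * (2 * O2p / (o2 * (2 * o0 ^+ 2 + gamma * o2))
             - 1 / (2 * o0 ^+ 2) - 1 / (2 * o2 ^+ 2) + 3 / (2 * g * k0)
             - (o2 + o0) / (2 * o2 * o0 * (2 * O0 + O2m))).

Definition c2l : R :=
  - (k0 ^+ 3 * (2 * o0 ^+ 2 - gamma * o2) ^+ 2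
     / (16 * pi * o0 ^+ 2 * o2 * (2 * O0 - O2p))).

Definition c2r : R :=
  g * c2l * (2 * O2m / (o2 * (2 * o0 ^+ 2 - gamma * o2))
             - 1 / (2 * o0 ^+ 2) - 1 / (2 * o2 ^+ 2) + 3 / (2 * g * k0)
             - (o2 - o0) / (2 * o2 * o0 * (2 * O0 - O2p))).

Definition c3l : R := gamma ^+ 2 * k0 ^+ 2 * o0 / (2 * pi * g * O0).

Definition c3r1 : R := c3l * (1 / k0 + g * gamma / (8 * O0 * o0 ^+ 2)).

Definition beta : R := 8 * pi * (c0r - (c1r + c2r + c3r1) / 2).

End WaterWaves.

(* Main.v *)
Require Import Defs.
From HB Require Import structures.
From mathcomp Require Import all_boot all_order all_algebra.
From mathcomp Require Import all_classical all_reals all_analysis.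
From mathcomp Require Import complex.
From mathcomp Require Import measurable_realfun ring lra.
Import Order.TTheory GRing.Theory Num.Theory numFieldNormedType.Exports.

(** The error terms of the hypothesis and of the conclusion coincide for every
    [eps > 0], so the statement is a collection of exact identities between
    integrals in frequency and integrals in position.

    The basic tool is the multiplication formula [ifourier_pairing], a
    consequence of Fubini: for integrable [f] and [v], the integral of
    [f * ifourier v] equals that of [v * ifourier f], up to modulations and
    scalings. Since the profile [U] is continuous and both [U] and
    [u = ifourier U] are integrable, [fourier_inversion] gives
    [fourier u = U]; in particular the conjugate of [U] is itself the inverse
    transform of the conjugate of [u]. Inversion is proved by Abel summation: the
    damping factor [exp (- d |x|)] has the Poisson kernel as transform.

    - Quadratic part ([H2_modulated]): substitute [k = k0 + eps * l] and apply the
      multiplication formula once.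
    - Quartic part with kernel [1], [l2] or [l3] ([cint3_separable]): apply the
      multiplication formula in each of the three frequency variables. A factor
      [l2] or [l3] becomes a derivative of [u] or of its conjugate
      ([cderive_ifourier]), whence the local term and the current term, with the
      factors [2 * pi] and [4 * pi].
    - Quartic part with kernel [|l1 - l3|] ([quartic_int_abs]): only the frequency
      transfer [l = l1 - l3] matters. The autocorrelation of [U] is, up to a
      constant, the transform of [|u|^2], so two exchanges of integrals reduce the form to the pairing of
      [|u|^2] with [|D|] applied to [|u|^2].

    The moment hypothesis on [(1 + |l|) * U l] makes all the exchanges of
    integrals absolutely convergent. *)

Set Implicit Arguments.
Unset Strict Implicit.
Unset Printing Implicit Defensive.

Local Open Scope classical_set_scope.
Local Open Scope ring_scope.
Local Open Scope complex_scope.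

(** * Componentwise integration of complex functions *)

(** Lebesgue integrable real functions on the line. *)
Definition L1 {R : realType} (f : R -> R) : Prop :=
  (@lebesgue_measure R).-integrable setT (EFin \o f).

(** The norm [|Re z| + |Im z|], equivalent to the modulus. Being a sum of the
    two components, it turns domination of a complex integrand into domination
    of the componentwise integrands that define [cint]. *)
Definition norm1 {R : realType} (z : R[i]) : R :=
  `|complex.Re z| + `|complex.Im z|.

(** Componentwise measurability of a complex-valued function. *)
Definition cmeasurable {R : realType} {d} {T : measurableType d} (f : T -> R[i]) : Prop :=
  measurable_fun setT (fun x => complex.Re (f x)) /\
  measurable_fun setT (fun x => complex.Im (f x)).

Section Basics.
Context {R : realType}.
Local Notation mu := (@lebesgue_measure R).
Implicit Types (f g : R -> R[i]) (z w : R[i]).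

Lemma norm1_ge0 z : 0 <= norm1 z.
Proof. by rewrite addr_ge0. Qed.

Lemma norm1M z w : norm1 (z * w) <= norm1 z * norm1 w.
Proof.
case: z w => a b [c d]; rewrite /norm1 /=.
rewrite (le_trans (lerD (ler_normB _ _) (ler_normD _ _)))//.
by rewrite !normrM; lra.
Qed.

Lemma norm1D z w : norm1 (z + w) <= norm1 z + norm1 w.
Proof.
case: z w => a b [c d]; rewrite /norm1 /=.
by rewrite (le_trans (lerD (ler_normD _ _) (ler_normD _ _)))//; lra.
Qed.

Lemma norm1N z : norm1 (- z) = norm1 z.
Proof. by case: z => a b; rewrite /norm1 /= !normrN. Qed.

Lemma norm1J z : norm1 (z^*%C) = norm1 z.
Proof. by case: z => a b; rewrite /norm1 /= normrN. Qed.

Lemma norm1R (r : R) : norm1 r%:C = `|r|.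
Proof. by rewrite /norm1 /= normr0 addr0. Qed.

Lemma norm1_cis (t : R) : norm1 (cis t) <= 2.
Proof.
by rewrite /norm1 /=; have := cos_max t; have := sin_max t; lra.
Qed.

Lemma norm1_eq0 z : norm1 z = 0 -> z = 0.
Proof.
case: z => a b; rewrite /norm1 /= => /eqP; rewrite paddr_eq0// !normr_eq0.
by move=> /andP[/eqP-> /eqP->].
Qed.

Lemma cisD (s t : R) : cis (s + t) = cis s * cis t.
Proof. by rewrite /cis cosD sinD /=; simpc; rewrite [sin s * cos t + _]addrC. Qed.

Lemma cisJ (s : R) : (cis s)^*%C = cis (- s).
Proof. by rewrite /cis cosN sinN. Qed.

Lemma cis0 : cis (0 : R) = 1.
Proof. by rewrite /cis cos0 sin0. Qed.

Lemma conjcM z w : (z * w)^*%C = z^*%C * w^*%C.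
Proof. exact: rmorphM. Qed.

Lemma conjcR (r : R) : (r%:C)^*%C = r%:C.
Proof. by simpc. Qed.

Section Measurability.
Context {d} {T : measurableType d}.
Implicit Types F G : T -> R[i].

Lemma cmeasurableM F G : cmeasurable F -> cmeasurable G -> cmeasurable (fun x => F x * G x).
Proof.
move=> [mF1 mF2] [mG1 mG2]; split.
- rewrite (_ : (fun x => _) = (fun x => complex.Re (F x) * complex.Re (G x)
    - complex.Im (F x) * complex.Im (G x))).
    by apply: measurable_funB; apply: measurable_funM.
  by apply/funext => x; case: (F x) (G x) => a b [].
- rewrite (_ : (fun x => _) = (fun x => complex.Re (F x) * complex.Im (G x)
    + complex.Im (F x) * complex.Re (G x))).
    by apply: measurable_funD; apply: measurable_funM.
  by apply/funext => x; case: (F x) (G x) => a b [c e] /=; rewrite addrC.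
Qed.

Lemma cmeasurableD F G : cmeasurable F -> cmeasurable G -> cmeasurable (fun x => F x + G x).
Proof.
move=> [mF1 mF2] [mG1 mG2]; split.
- rewrite (_ : (fun x => _) = (fun x => complex.Re (F x) + complex.Re (G x))).
    exact: measurable_funD.
  by apply/funext => x; case: (F x) (G x) => a b [].
- rewrite (_ : (fun x => _) = (fun x => complex.Im (F x) + complex.Im (G x))).
    exact: measurable_funD.
  by apply/funext => x; case: (F x) (G x) => a b [].
Qed.

Lemma cmeasurableJ F : cmeasurable F -> cmeasurable (fun x => (F x)^*%C).
Proof.
move=> [mF1 mF2]; split.
- by rewrite (_ : (fun x => _) = (fun x => complex.Re (F x)))//;
    apply/funext => x; case: (F x).
- rewrite (_ : (fun x => _) = (fun x => - complex.Im (F x))).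
    exact: measurable_funN.
  by apply/funext => x; case: (F x).
Qed.

Lemma cmeasurable_cst z : cmeasurable (fun _ : T => z).
Proof. by split; apply: measurable_cst. Qed.

Lemma cmeasurableR (h : T -> R) : measurable_fun setT h -> cmeasurable (fun x => (h x)%:C).
Proof. by move=> mh; split => //=; apply: measurable_cst. Qed.

Lemma cmeasurable_comp {d'} {T' : measurableType d'} F (h : T' -> T) :
  cmeasurable F -> measurable_fun setT h -> cmeasurable (F \o h).
Proof.
move=> [mF1 mF2] mh; split.
- exact: (measurableT_comp mF1 mh).
- exact: (measurableT_comp mF2 mh).
Qed.

Lemma cmeasurable_cis (h : T -> R) : measurable_fun setT h -> cmeasurable (fun x => cis (h x)).
Proof.
move=> mh; split => /=.
- exact: (measurableT_comp (continuous_measurable_fun (@continuous_cos R)) mh).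
- exact: (measurableT_comp (continuous_measurable_fun (@continuous_sin R)) mh).
Qed.

Lemma measurable_norm1 F : cmeasurable F -> measurable_fun setT (fun x => norm1 (F x)).
Proof.
move=> [mF1 mF2]; apply: measurable_funD.
- exact: (measurableT_comp (@normr_measurable R setT) mF1).
- exact: (measurableT_comp (@normr_measurable R setT) mF2).
Qed.

End Measurability.

Lemma cintegrable_cmeasurable f : cintegrable f -> cmeasurable f.
Proof.
by move=> [/(measurable_int mu)/measurable_EFinP ? /(measurable_int mu)/measurable_EFinP ?].
Qed.

Lemma ccontinuous_cmeasurable f : ccontinuous f -> cmeasurable f.
Proof. by move=> [? ?]; split; exact: continuous_measurable_fun. Qed.

Lemma L1_dom (h g : R -> R) : measurable_fun setT h -> L1 g ->
  (forall x, `|h x| <= g x) -> L1 h.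
Proof.
move=> mh ig hg; apply: (le_integrable measurableT _ _ ig).
  exact/measurable_EFinP.
by move=> x _ /=; rewrite lee_fin (le_trans (hg x))// ler_norm.
Qed.

Lemma L1D (h g : R -> R) : L1 h -> L1 g -> L1 (fun x => h x + g x).
Proof. by move=> ih ig; exact: (integrableD measurableT ih ig). Qed.

Lemma L1Zl (k : R) (h : R -> R) : L1 h -> L1 (fun x => k * h x).
Proof. by move=> ih; exact: (integrableZl measurableT k ih). Qed.

Lemma L1norm (h : R -> R) : L1 h -> L1 (fun x => `|h x|).
Proof. by move=> ih; exact: (integrable_norm ih). Qed.

Lemma L1_cintegrable f : L1 (fun x => complex.Re (f x)) ->
  L1 (fun x => complex.Im (f x)) -> cintegrable f.
Proof. by []. Qed.

Lemma cintegrable_dom f (g : R -> R) : cmeasurable f -> L1 g ->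
  (forall x, norm1 (f x) <= g x) -> cintegrable f.
Proof.
move=> [mf1 mf2] ig fg; apply: L1_cintegrable; apply: (L1_dom _ ig _) => //.
- by move=> x; apply: le_trans (fg x); rewrite lerDl.
- by move=> x; apply: le_trans (fg x); rewrite lerDr.
Qed.

Lemma L1_norm1 f : cintegrable f -> L1 (fun x => norm1 (f x)).
Proof. by move=> [i1 i2]; apply: L1D; apply: L1norm. Qed.

Lemma cintegrable_bounded f g (C : R) : cintegrable f -> cmeasurable g ->
  (forall x, norm1 (g x) <= C) -> cintegrable (fun x => g x * f x).
Proof.
move=> fi mg gC; apply: (@cintegrable_dom _ (fun x => C * norm1 (f x))).
- by apply: cmeasurableM => //; exact: cintegrable_cmeasurable.
- exact/L1Zl/L1_norm1.
- by move=> x; rewrite (le_trans (norm1M _ _))// ler_wpM2r ?norm1_ge0.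
Qed.

Lemma cintegrableD f g : cintegrable f -> cintegrable g ->
  cintegrable (fun x => f x + g x).
Proof.
move=> fi gi; apply: (@cintegrable_dom _ (fun x => norm1 (f x) + norm1 (g x))).
- by apply: cmeasurableD; exact: cintegrable_cmeasurable.
- by apply: L1D; exact: L1_norm1.
- by move=> x; exact: norm1D.
Qed.

Lemma cintegrableZ z f : cintegrable f -> cintegrable (fun x => z * f x).
Proof.
by move=> fi; apply: (cintegrable_bounded (C := norm1 z) fi) => //;
  exact: cmeasurable_cst.
Qed.

Lemma cintegrableJ f : cintegrable f -> cintegrable (fun x => (f x)^*%C).
Proof.
move=> fi; apply: (cintegrable_dom (g := fun x => norm1 (f x))).
- exact/cmeasurableJ/cintegrable_cmeasurable.
- exact: L1_norm1.
- by move=> x; rewrite norm1J.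
Qed.

Lemma cintegrable_cis f (h : R -> R) : measurable_fun setT h -> cintegrable f ->
  cintegrable (fun x => cis (h x) * f x).
Proof.
move=> mh fi; apply: (cintegrable_bounded (C := 2) fi).
- exact: cmeasurable_cis.
- by move=> x; exact: norm1_cis.
Qed.

Lemma cintegrableR (h : R -> R) : L1 h -> cintegrable (fun x => (h x)%:C).
Proof.
move=> ih; split => //=.
exact: (integrable0 mu setT).
Qed.

Lemma rint_eq (h k : R -> R) : (forall x, h x = k x) -> rint h = rint k.
Proof. by move=> /funext->. Qed.

Lemma rintD (h k : R -> R) : L1 h -> L1 k ->
  rint (fun x => h x + k x) = rint h + rint k.
Proof. by move=> ih ik; rewrite /rint RintegralD. Qed.

Lemma rintB (h k : R -> R) : L1 h -> L1 k ->
  rint (fun x => h x - k x) = rint h - rint k.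
Proof. by move=> ih ik; rewrite /rint RintegralB. Qed.

Lemma rintZl (k : R) (h : R -> R) : L1 h -> rint (fun x => k * h x) = k * rint h.
Proof. by move=> ih; rewrite /rint RintegralZl. Qed.

Lemma rintN (h : R -> R) : L1 h -> rint (fun x => - h x) = - rint h.
Proof.
move=> ih; rewrite -mulN1r -rintZl//; apply: rint_eq => x.
by rewrite mulN1r.
Qed.

Lemma rint_le (h k : R -> R) : L1 h -> L1 k -> (forall x, h x <= k x) ->
  rint h <= rint k.
Proof. by move=> ih ik hk; apply: le_Rintegral. Qed.

Lemma rint_norm (h : R -> R) : L1 h -> `|rint h| <= rint (fun x => `|h x|).
Proof. by move=> ih; apply: le_normr_Rintegral. Qed.

Lemma cint_eq f g : (forall x, f x = g x) -> cint f = cint g.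
Proof. by move=> /funext->. Qed.

Lemma cintD f g : cintegrable f -> cintegrable g ->
  cint (fun x => f x + g x) = cint f + cint g.
Proof.
move=> [f1 f2] [g1 g2]; rewrite /cint; simpc.
rewrite -rintD// -rintD//; congr (_ +i* _); apply: rint_eq => x;
  by case: (f x) (g x) => a b [].
Qed.

Lemma cintZ z f : cintegrable f -> cint (fun x => z * f x) = z * cint f.
Proof.
move=> [f1 f2]; case: z => a b; rewrite /cint; simpc.
congr (_ +i* _).
- rewrite -!rintZl// -rintB//; do ?exact: L1Zl.
  by apply: rint_eq => x; case: (f x).
- rewrite -!rintZl// -rintD//; do ?exact: L1Zl.
  by apply: rint_eq => x; case: (f x) => c d /=.
Qed.

Lemma cintJ f : cintegrable f -> cint (fun x => (f x)^*%C) = (cint f)^*%C.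
Proof.
move=> [f1 f2]; rewrite /cint; simpc; congr (_ +i* _).
- by apply: rint_eq => x; case: (f x).
- by rewrite -rintN//; apply: rint_eq => x; case: (f x).
Qed.

Lemma cintR (h : R -> R) : cint (fun x => (h x)%:C) = (rint h)%:C.
Proof. by rewrite /cint /= /rint /Rintegral integral0. Qed.

Lemma norm1_cint f : cintegrable f -> norm1 (cint f) <= rint (fun x => norm1 (f x)).
Proof.
move=> [f1 f2]; rewrite /norm1 rintD; [|exact: L1norm..].
by rewrite lerD//= rint_norm.
Qed.

End Basics.

(** * Iterated integrals and affine substitution *)

Section Fubini.
Context {R : realType}.
Local Notation mu := (@lebesgue_measure R).

(** An integrable extended-real function is finite almost everywhere, so [fine]
    changes neither its integrability nor its integral. This allows iterated
    real-valued integrals without integrability of every section. *)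
Lemma integral_fine (F : R -> \bar R) : mu.-integrable setT F ->
  L1 (fun x => fine (F x)) /\
  (\int[mu]_x (fine (F x))%:E = \int[mu]_x F x)%E.
Proof.
move=> iF; have mF := measurable_int mu iF.
have mfF : measurable_fun setT (fun x => fine (F x)).
  exact: (measurableT_comp (@fine_measurable R setT measurableT) mF).
split.
- apply: (le_integrable measurableT _ _ iF); first exact/measurable_EFinP.
  move=> x _ /=; by case: (F x) => [r| |] //=; rewrite ?normr0 ?leey.
- apply: ae_eq_integral => //; first exact/measurable_EFinP.
  apply: filterS (integrable_ae measurableT iF) => x /(_ I) Fx _.
  by rewrite fineK.
Qed.

Lemma rint_fubini (f : R * R -> R) : (mu \x mu)%E.-integrable setT (EFin \o f) ->
  [/\ L1 (fun x => rint (fun y => f (x, y))),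
      L1 (fun y => rint (fun x => f (x, y))) &
      rint (fun x => rint (fun y => f (x, y))) =
      rint (fun y => rint (fun x => f (x, y)))].
Proof.
move=> fi.
have mf := measurable_int _ fi.
have fi' : (mu \x mu)%E.-integrable setT (EFin \o (fun z => f (z.2, z.1))).
  apply/integrable12ltyP => /=.
    apply: (measurableT_comp mf); exact: measurable_swap.
  exact: (integrable21ltyP mu mu mf).1.
have [i1 e1] := integral_fine (integrable_fubini_F fi).
have [i2 e2] := integral_fine (integrable_fubini_F fi').
split; [exact: i1|exact: i2|].
rewrite /rint /Rintegral; congr fine.
exact: (etrans e1 (etrans (Fubini fi) (esym e2))).
Qed.

(** Behaviour of Lebesgue measure under the substitution [x |-> a * x + b]: both
    sides are measures in [A] that agree on half-open intervals. *)
Lemma lebesgue_measure_affine (a b : R) (A : set R) : a != 0 -> measurable A ->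
  mu A = (`|a|%:E * mu ((fun x => (a * x + b)%R) @^-1` A))%E.
Proof.
move=> a0 mA.
have mphi : measurable_fun setT (fun x : R => a * x + b : measurableTypeR R).
  by apply: measurable_funD => //; apply: measurable_funM.
pose k : {nonneg R} := NngNum (normr_ge0 a).
pose nu := mscale k (pushforward mu (fun x : R => a * x + b : measurableTypeR R)).
suff: mu A = nu mphi A by [].
move: A mA; apply: lebesgue_measure_unique => // _ [[c d]] _ <-.
suff: mu `]c, d]%classic =
    (`|a|%:E * mu ((fun x => (a * x + b)%R) @^-1` `]c, d]))%E by [].
have [a_gt0|a_lt0|/eqP] := ltgtP 0 a; last by rewrite eq_sym (negbTE a0).
- have E : (fun x : R => a * x + b) @^-1` `]c, d]%classic
      = `](c - b) / a, (d - b) / a]%classic.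
    apply/seteqP; split => x /=; rewrite !in_itv /= ltr_pdivrMr// ler_pdivlMr//;
      rewrite ltrBlDr lerBrDr mulrC//.
  rewrite E !lebesgue_measure_itv /= !lte_fin ltr_pM2r ?invr_gt0// ltrD2r.
  case: ifP => // _; last by rewrite mule0.
  by rewrite gtr0_norm// -!EFinB -EFinM; congr EFin; field.
- have E : (fun x : R => a * x + b) @^-1` `]c, d]%classic
      = `[(d - b) / a, (c - b) / a[%classic.
    apply/seteqP; split => x /=; rewrite !in_itv /= ltr_ndivlMr// ler_ndivrMr//;
      rewrite ltrBlDr lerBrDr mulrC// andbC//.
  rewrite E !lebesgue_measure_itv /= !lte_fin ltr_nM2r ?invr_lt0// ltrD2r.
  case: ifP => // _; last by rewrite mule0.
  by rewrite ltr0_norm// -!EFinB -EFinM; congr EFin; field.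
Qed.

Lemma ge0_integral_affine (a b : R) (f : R -> \bar R) : a != 0 ->
  measurable_fun setT f -> (forall x, 0 <= f x)%E ->
  (\int[mu]_x f x = `|a|%:E * \int[mu]_x f (a * x + b)%R)%E.
Proof.
move=> a0 mf f0.
pose phi : measurableTypeR R -> measurableTypeR R := fun x : R => a * x + b.
have mphi : measurable_fun setT phi.
  by apply: measurable_funD => //; apply: measurable_funM.
have E := ge0_integral_pushforward mphi mu measurableT mf (fun x _ => f0 x).
rewrite preimage_setT in E.
transitivity (`|a|%:E * \int[mu]_x (f \o phi) x)%E; last by [].
rewrite -E.
pose k : {nonneg R} := NngNum (normr_ge0 a).
rewrite -(ge0_integral_mscale _ measurableT k)//.
apply: eq_measure_integral => A mA _.
exact: lebesgue_measure_affine.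
Qed.

Lemma L1_affine (a b : R) (f : R -> R) : a != 0 -> L1 f ->
  L1 (fun x => f (a * x + b)).
Proof.
move=> a0 /integrableP[mf fi].
have mphi : measurable_fun setT (fun x : R => a * x + b : measurableTypeR R).
  by apply: measurable_funD => //; apply: measurable_funM.
apply/integrableP; split.
  exact: (measurableT_comp mf mphi).
move: fi; rewrite (@ge0_integral_affine a b)//; last first.
  exact: measurableT_comp.
rewrite ltey => h; rewrite ltey; apply: contra h => /eqP E.
by rewrite [X in (_ * X)%E]E gt0_muley// lte_fin normr_gt0.
Qed.

Lemma rint_affine (a b : R) (f : R -> R) : a != 0 -> L1 f ->
  rint f = `|a| * rint (fun x => f (a * x + b)).
Proof.
move=> a0 fi; have fi' := L1_affine b a0 fi.
rewrite /rint /Rintegral -[`|a|]/(fine `|a|%:E) -fineM//; last first.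
  exact: integrable_fin_num.
congr fine; rewrite integralE [in RHS]integralE.
rewrite muleBr//; last exact: integrable_add_def.
have mf := measurable_int mu fi.
congr (_ - _)%E.
- rewrite (ge0_integral_affine b a0 (measurable_funepos mf) (funepos_ge0 _)).
  by congr (_ * _)%E; apply: eq_integral => x _; rewrite !unlock.
- rewrite (ge0_integral_affine b a0 (measurable_funeneg mf) (funeneg_ge0 _)).
  by congr (_ * _)%E; apply: eq_integral => x _; rewrite !unlock.
Qed.

End Fubini.

Section CFubini.
Context {R : realType}.
Local Notation mu := (@lebesgue_measure R).
Implicit Types (f g : R -> R[i]).

(** Integrability on the plane with respect to the product measure. *)
Definition L1pair (h : R * R -> R) : Prop :=
  (mu \x mu)%E.-integrable setT (EFin \o h).

Lemma L1_measurable (h : R -> R) : L1 h -> measurable_fun setT h.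
Proof. by move/(measurable_int mu)/measurable_EFinP. Qed.

Lemma L1_lty (h : R -> R) : L1 h -> (\int[mu]_x `|h x|%:E < +oo)%E.
Proof. by move/integrableP => [_]. Qed.

Lemma L1pair_prod (h k : R -> R) : L1 h -> L1 k ->
  L1pair (fun z => h z.1 * k z.2).
Proof.
move=> ih ik; have mh := L1_measurable ih; have mk := L1_measurable ik.
apply/integrable12ltyP => /=.
  apply/measurable_EFinP; apply: measurable_funM.
  - exact: (measurableT_comp mh measurable_fst).
  - exact: (measurableT_comp mk measurable_snd).
under eq_integral => x _.
  under eq_integral do rewrite normrM EFinM.
  rewrite ge0_integralZl_EFin//; last first.
    exact/measurable_EFinP/(measurableT_comp (@normr_measurable R setT)).
  over.
rewrite ge0_integralZr//; [|exact/measurable_EFinP/(measurableT_comp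
  (@normr_measurable R setT))|exact: integral_ge0].
by rewrite lte_mul_pinfty ?integral_ge0 ?L1_lty// ge0_fin_numE ?L1_lty ?integral_ge0.
Qed.

(** The integrand of a convolution of two integrable functions is integrable on
    the plane. *)
Lemma L1pair_conv (h k : R -> R) : L1 h -> L1 k ->
  L1pair (fun z => h z.1 * k (z.1 - z.2)).
Proof.
move=> ih ik; have mh := L1_measurable ih; have mk := L1_measurable ik.
apply/integrable12ltyP => /=.
  apply/measurable_EFinP; apply: measurable_funM.
  - exact: (measurableT_comp mh measurable_fst).
  - apply: (measurableT_comp mk); apply: measurable_funB.
      exact: measurable_fst.
    exact: measurable_snd.
have kE x : (\int[mu]_y `|k (x - y)|%:E = \int[mu]_y `|k y|%:E)%E.
  rewrite [RHS](@ge0_integral_affine _ (-1) x)//.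
    rewrite normrN1 mul1e; apply: eq_integral => y _.
    by rewrite mulN1r addrC.
  exact/measurable_EFinP/(measurableT_comp (@normr_measurable R setT)).
under eq_integral => x _.
  under eq_integral do rewrite normrM EFinM.
  rewrite ge0_integralZl_EFin//; last first.
  - apply/measurable_EFinP/(measurableT_comp (@normr_measurable R setT)).
    by apply: measurableT_comp => //; apply: measurable_funB.
  rewrite kE.
  over.
rewrite ge0_integralZr//; [|exact/measurable_EFinP/(measurableT_comp
  (@normr_measurable R setT))|exact: integral_ge0].
by rewrite lte_mul_pinfty ?integral_ge0 ?L1_lty// ge0_fin_numE ?L1_lty ?integral_ge0.
Qed.

(** Fubini for complex integrands dominated by an integrable function. *)
Lemma cint_fubini (F : R * R -> R[i]) (G : R * R -> R) : cmeasurable F -> L1pair G ->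
  (forall z, norm1 (F z) <= G z) ->
  [/\ cintegrable (fun x => cint (fun y => F (x, y))),
      cintegrable (fun y => cint (fun x => F (x, y))) &
      cint (fun x => cint (fun y => F (x, y))) =
      cint (fun y => cint (fun x => F (x, y)))].
Proof.
move=> [mF1 mF2] iG FG.
have L1pair_dom (h : R * R -> R) : measurable_fun setT h ->
    (forall z, `|h z| <= G z) -> L1pair h.
  move=> mh hG; apply: (le_integrable measurableT _ _ iG).
    exact/measurable_EFinP.
  by move=> z _ /=; rewrite lee_fin (le_trans (hG z))// ler_norm.
have [r1 r2 r3] := rint_fubini (L1pair_dom _ mF1
  (fun z => le_trans (ler_wpDr (normr_ge0 _) (lexx _)) (FG z))).
have [s1 s2 s3] := rint_fubini (L1pair_dom _ mF2
  (fun z => le_trans (ler_wpDl (normr_ge0 _) (lexx _)) (FG z))).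
split; [by split|by split|].
by rewrite /cint /= r3 s3.
Qed.

Lemma cintegrable_affine (a b : R) f : a != 0 -> cintegrable f ->
  cintegrable (fun x => f (a * x + b)).
Proof.
move=> a0 [f1 f2]; split.
- exact: (L1_affine b a0 f1).
- exact: (L1_affine b a0 f2).
Qed.

Lemma cint_affine (a b : R) f : a != 0 -> cintegrable f ->
  cint f = `|a|%:C * cint (fun x => f (a * x + b)).
Proof.
move=> a0 [f1 f2]; rewrite /cint; simpc.
by congr (_ +i* _); apply: rint_affine.
Qed.

Lemma cint_reflect (b : R) f : cintegrable f ->
  cint (fun x => f (b - x)) = cint f.
Proof.
move=> fi; rewrite [RHS](@cint_affine (-1) b)// ?oppr_eq0 ?oner_eq0//.
rewrite normrN1 mul1r; apply: cint_eq => x.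
by rewrite mulN1r addrC.
Qed.

End CFubini.

(** * The multiplication formula *)

Section FourierPairing.
Context {R : realType}.
Implicit Types (f v : R -> R[i]).
Local Notation c := ((Num.sqrt (2 * pi))^-1 : R).

Lemma sqrt2pi_gt0 : 0 < Num.sqrt (2 * pi) :> R.
Proof. by rewrite sqrtr_gt0 mulr_gt0 ?pi_gt0. Qed.

Lemma sqrt2pi_sq : (Num.sqrt (2 * pi) : R)%:C * (Num.sqrt (2 * pi) : R)%:C = (2 * pi)%:C.
Proof.
have p0 : 0 <= 2 * pi :> R by rewrite mulr_ge0// pi_ge0.
by rewrite -rmorphM /= -expr2 (sqr_sqrtr p0).
Qed.

Lemma sqrt2piVK : ((Num.sqrt (2 * pi) : R)^-1)%:C * (Num.sqrt (2 * pi) : R)%:C = 1.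
Proof. by rewrite -rmorphM /= mulVf// gt_eqF// sqrt2pi_gt0. Qed.

Lemma fourier_ifourier f l : fourier f l = ifourier f (- l).
Proof.
by rewrite /fourier /ifourier; congr (_ * _); apply: cint_eq => x;
  rewrite mulrN [l * x]mulrC.
Qed.

Lemma cintegrable_cisM f x : cintegrable f -> cintegrable (fun l => cis (l * x) * f l).
Proof. by move=> fi; apply: cintegrable_cis => //; apply: measurable_funM. Qed.

Lemma ifourierJ f x : cintegrable f ->
  (ifourier f x)^*%C = ifourier (fun l => (f l)^*%C) (- x).
Proof.
move=> fi; rewrite /ifourier conjcM conjcR -cintJ; last exact: cintegrable_cisM.
congr (_ * _); apply: cint_eq => l.
by rewrite conjcM cisJ mulrN.
Qed.

Lemma ifourierZ z f x : cintegrable f ->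
  ifourier (fun l => z * f l) x = z * ifourier f x.
Proof.
move=> fi; rewrite /ifourier mulrCA; congr (_ * _).
rewrite -cintZ; last exact: cintegrable_cisM.
by apply: cint_eq => l; rewrite mulrCA.
Qed.

Lemma norm1_ifourier f x : cintegrable f ->
  norm1 (ifourier f x) <= c * (2 * rint (fun l => norm1 (f l))).
Proof.
move=> fi; rewrite /ifourier (le_trans (norm1M _ _))//.
have c0 : 0 <= c by rewrite invr_ge0 sqrtr_ge0.
rewrite norm1R ger0_norm// ler_wpM2l//.
rewrite (le_trans (norm1_cint (cintegrable_cisM _ fi)))//.
rewrite -rintZl; last exact: L1_norm1.
apply: rint_le.
- exact/L1_norm1/cintegrable_cisM.
- exact/L1Zl/L1_norm1.
- by move=> l; rewrite (le_trans (norm1M _ _))// ler_wpM2r ?norm1_ge0 ?norm1_cis.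
Qed.

(** The multiplication formula of Fourier analysis, with an affine change of the
    frequency variable: the transform moves from one factor to the other. It is
    the only form of Parseval's identity that the argument needs. *)
Lemma ifourier_pairing (s t : R) f v : cintegrable f -> cintegrable v ->
  [/\ cintegrable (fun l => f l * ifourier v (s + t * l)),
      cintegrable (fun x => cis (x * s) * v x * ifourier f (t * x)) &
      cint (fun l => f l * ifourier v (s + t * l)) =
      cint (fun x => cis (x * s) * v x * ifourier f (t * x))].
Proof.
move=> fi vi.
pose F (z : R * R) := c%:C * (cis (z.2 * (s + t * z.1)) * (f z.1 * v z.2)).
have m1 : measurable_fun setT (fun z : R * R => z.1) by exact: measurable_fst.
have m2 : measurable_fun setT (fun z : R * R => z.2) by exact: measurable_snd.
have mF : cmeasurable F.
  apply: cmeasurableM; first exact: cmeasurable_cst.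
  apply: cmeasurableM.
    apply: cmeasurable_cis; apply: measurable_funM => //.
    by apply: measurable_funD => //; apply: measurable_funM.
  apply: cmeasurableM.
    exact: (cmeasurable_comp (cintegrable_cmeasurable fi) m1).
  exact: (cmeasurable_comp (cintegrable_cmeasurable vi) m2).
have c0 : 0 <= c by rewrite invr_ge0 sqrtr_ge0.
have [] := cint_fubini mF
  (L1pair_prod (L1Zl (c * 2) (L1_norm1 fi)) (L1_norm1 vi)).
- move=> [l x] /=; rewrite /F /= -!mulrA (le_trans (norm1M _ _))//.
  rewrite norm1R ger0_norm// ler_wpM2l// (le_trans (norm1M _ _))//.
  by rewrite ler_pM ?norm1_ge0 ?norm1_cis// norm1M.
have E1 l : cint (fun x => F (l, x)) = f l * ifourier v (s + t * l).
  rewrite /F /= /ifourier mulrCA -!cintZ; first last.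
  - exact: cintegrable_cisM.
  - exact/cintegrableZ/cintegrable_cisM.
  by apply: cint_eq => x; ring.
have E2 x : cint (fun l => F (l, x)) = cis (x * s) * v x * ifourier f (t * x).
  rewrite /F /= /ifourier mulrCA -!cintZ; first last.
  - exact: cintegrable_cisM.
  - exact/cintegrableZ/cintegrable_cisM.
  apply: cint_eq => l; rewrite [x * (s + _)]mulrDr cisD.
  rewrite (_ : x * (t * l) = l * (t * x)); last by ring.
  by ring.
rewrite (funext E1) (funext E2) => i1 i2 e; split; [exact: i1|exact: i2|exact: e].
Qed.

Lemma cintegrable_mul_ifourier f v (t : R) : cintegrable f -> cintegrable v ->
  cintegrable (fun x => v x * ifourier f (t * x)).
Proof.
move=> fi vi; have [_ + _] := ifourier_pairing 0 t fi vi.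
by under eq_fun do rewrite mulr0 cis0 mul1r.
Qed.

Lemma cint_cis_ifourier v s : cintegrable v ->
  cint (fun x => cis (x * s) * v x) = (Num.sqrt (2 * pi))%:C * ifourier v s.
Proof.
move=> vi; rewrite /ifourier mulrA -rmorphM /= divff ?mul1r//.
by rewrite gt_eqF// sqrt2pi_gt0.
Qed.

(** The pairing with a shifted transform is itself a transform, so the pairing
    can be iterated. *)
Lemma cint_mul_ifourier f v s t : cintegrable f -> cintegrable v ->
  cint (fun l => f l * ifourier v (s + t * l)) =
  (Num.sqrt (2 * pi))%:C * ifourier (fun x => v x * ifourier f (t * x)) s.
Proof.
move=> fi vi; have [_ _ ->] := ifourier_pairing s t fi vi.
rewrite -cint_cis_ifourier; last exact: cintegrable_mul_ifourier.
by apply: cint_eq => x; rewrite mulrA.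
Qed.

End FourierPairing.

(** * Transform of the two-sided exponential *)

Section PoissonKernel.
Context {R : realType}.
Local Notation mu := (@lebesgue_measure R).

Lemma ge0_integral_L1 (h : R -> R) (m : R) : measurable_fun setT h ->
  (forall x, 0 <= h x) -> (\int[mu]_x (h x)%:E = m%:E)%E ->
  L1 h /\ rint h = m.
Proof.
move=> mh h0 hm; split; last by rewrite /rint /Rintegral hm.
apply/integrableP; split; first exact/measurable_EFinP.
by under eq_integral do rewrite /= ger0_norm//; rewrite hm ltry.
Qed.

Lemma is_derive_scale (a x : R) : is_derive x 1 (fun y : R => a * y) a.
Proof.
have H := is_deriveZ (f := id) a (is_derive_id x (1 : R)).
by apply: is_derive_eq H _; rewrite /GRing.scale /= mulr1.
Qed.

(** An antiderivative of [exp (- d y) * (1 + cos (s y))]. *)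
Lemma is_derive_exp_trig (d s x : R) : 0 < d ->
  is_derive x 1 (fun y => expR (- d * y) *
     (- d^-1 + (s / (d ^+ 2 + s ^+ 2) * sin (s * y)
                - d / (d ^+ 2 + s ^+ 2) * cos (s * y))))
  (expR (- d * x) * (1 + cos (s * x))).
Proof.
move=> d0.
have n0 : d ^+ 2 + s ^+ 2 != 0.
  by rewrite gt_eqF// ltr_wpDr ?sqr_ge0// exprn_gt0.
have hE := is_derive1_comp (is_derive_expR (- d * x)) (is_derive_scale (- d) x).
have hS := is_derive1_comp (is_derive_sin (s * x)) (is_derive_scale s x).
have hC := is_derive1_comp (is_derive_cos (s * x)) (is_derive_scale s x).
have hS' := is_deriveZ (s / (d ^+ 2 + s ^+ 2)) hS.
have hC' := is_deriveZ (d / (d ^+ 2 + s ^+ 2)) hC.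
have hT := is_deriveD (is_derive_cst (- d^-1) x (1 : R)) (is_deriveB hS' hC').
have H := is_deriveM hE hT.
apply: is_derive_eq H _.
have aux (e a b : R) :
  e * (0 + (s / (d ^+ 2 + s ^+ 2) * (b * s) - d / (d ^+ 2 + s ^+ 2) * (- a * s))) +
  (- d^-1 + (s / (d ^+ 2 + s ^+ 2) * a - d / (d ^+ 2 + s ^+ 2) * b)) * (e * - d)
  = e * (1 + b).
  by field; rewrite n0 gt_eqF.
exact: aux.
Qed.

Lemma cvg_expRM (d : R) : 0 < d -> expR (- d * x) @[x --> +oo] --> 0.
Proof.
move=> d0; apply/cvgrPdist_lt => e e0.
move/cvgrPdist_lt: (@cvgr_expR R) => /(_ e e0) [M [_ HM]].
exists (M / d); split; first exact: num_real.
move=> x /= Mx; rewrite mulNr; apply: HM.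
by rewrite -ltr_pdivrMl// mulrC.
Qed.

(** Adding [1] to the cosine makes the integrand nonnegative, so the improper
    fundamental theorem of calculus for nonnegative functions applies. *)
Lemma integral0y_exp_cos (d s : R) : 0 < d ->
  (\int[mu]_(x in `[0%R, +oo[) (expR (- d * x) * (1 + cos (s * x)))%:E =
  (d^-1 + d / (d ^+ 2 + s ^+ 2))%:E)%E.
Proof.
move=> d0.
pose c2 := s / (d ^+ 2 + s ^+ 2); pose c3 := d / (d ^+ 2 + s ^+ 2).
pose F (y : R) : R := expR (- d * y) * (- d^-1 + (c2 * sin (s * y) - c3 * cos (s * y))).
have dF (x : R) : is_derive x 1 F (expR (- d * x) * (1 + cos (s * x))).
  exact: is_derive_exp_trig.
have cF : continuous F.
  move=> x; apply: differentiable_continuous; apply/derivable1_diffP.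
  exact: (@ex_derive _ _ _ _ _ _ _ (dF x)).
rewrite (@ge0_continuous_FTC2y R _ F 0 0).
- by rewrite /F mulr0 expR0 mulr0 sin0 cos0 mulr0 mulr1 sub0r mul1r -EFinB sub0r opprD !opprK.
- move=> x _; apply: mulr_ge0; first exact: expR_ge0.
  by have := cos_geN1 (s * x); lra.
- apply: continuous_subspaceT => x.
  apply: cvgM.
    apply: (@continuous_comp _ _ _ ( *%R (- d)) expR).
      exact: mulrl_continuous.
    exact: continuous_expR.
  apply: cvgD; first exact: cvg_cst.
  apply: (@continuous_comp _ _ _ ( *%R s) cos).
    exact: mulrl_continuous.
  exact: continuous_cos.
- pose K := d^-1 + (`|c2| + `|c3|) + 1.
  have K0 : 0 < K by rewrite /K ltr_wpDl// !addr_ge0// invr_ge0 ltW.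
  apply/cvgrPdist_lt => e e0.
  have eK : 0 < e / K by rewrite divr_gt0.
  move/cvgrPdist_lt: (cvg_expRM d0) => /(_ _ eK).
  apply: filterS => x; rewrite !sub0r !normrN /F normrM.
  rewrite ltr_pdivlMr// => h; apply: le_lt_trans h.
  rewrite ler_wpM2l// /K (le_trans (ler_normD _ _))// normrN.
  rewrite [X in X + _]gtr0_norm ?invr_gt0// -addrA lerD2l.
  rewrite (le_trans (ler_normB _ _))// !normrM ler_wpDr// lerD// ler_piMr//.
    exact: sin_max.
  exact: cos_max.
- by move=> x _; exact: (@ex_derive _ _ _ _ _ _ _ (dF x)).
- exact/cvg_at_right_filter/cF.
- by move=> x _; rewrite derive1E; exact: (@derive_val _ _ _ _ _ _ _ (dF x)).
Qed.

(** The two-sided exponential [exp (- d |x|)], used as a summability factor. *)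
Definition laplace (d : R) (x : R) : R := expR (- d * `|x|).

Lemma continuous_laplace d : continuous (laplace d).
Proof.
move=> x; apply: (@continuous_comp _ _ _ (fun x : R => - d * `|x|) expR).
  apply: cvgM; first exact: cvg_cst.
  exact: norm_continuous.
exact: continuous_expR.
Qed.

Lemma rint_laplace_1Dcos (d s : R) : 0 < d ->
  L1 (fun x => laplace d x * (1 + cos (s * x))) /\
  rint (fun x => laplace d x * (1 + cos (s * x))) =
  2 * (d^-1 + d / (d ^+ 2 + s ^+ 2)).
Proof.
move=> d0.
have ch : continuous (fun x => laplace d x * (1 + cos (s * x))).
  move=> x; apply: cvgM; first exact: continuous_laplace.
  apply: cvgD; first exact: cvg_cst.
  apply: (@continuous_comp _ _ _ ( *%R s) cos).
    exact: mulrl_continuous.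
  exact: continuous_cos.
have h0 x : 0 <= laplace d x * (1 + cos (s * x)).
  apply: mulr_ge0; first exact: expR_ge0.
  by have := cos_geN1 (s * x); lra.
apply: ge0_integral_L1 => //; first exact: continuous_measurable_fun.
rewrite ge0_symfun_integralT//; last first.
  by move=> x /=; rewrite /laplace normrN mulrN cosN.
rewrite EFinM; congr (_ * _)%E; rewrite -(integral0y_exp_cos s d0).
rewrite (_ : [set x | _] = `[0, +oo[%classic); last first.
  by apply/seteqP; split => x/=; rewrite in_itv/= andbT.
apply: eq_integral => x; rewrite inE/= in_itv/= andbT => x0.
by rewrite /laplace ger0_norm.
Qed.

Lemma L1_laplace d : 0 < d -> L1 (laplace d) /\ rint (laplace d) = 2 / d.
Proof.
move=> d0; have [i e] := rint_laplace_1Dcos 0 d0.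
have E : laplace d = fun x => 2^-1 * (laplace d x * (1 + cos (0 * x))).
  by apply/funext => x; rewrite mul0r cos0; field.
split; first by rewrite E; exact: L1Zl.
rewrite E rintZl// e; field; rewrite ?gt_eqF//.
Qed.

Lemma rint_laplace_cos (d s : R) : 0 < d ->
  rint (fun x => laplace d x * cos (s * x)) = 2 * d / (d ^+ 2 + s ^+ 2).
Proof.
move=> d0; have [i e] := rint_laplace_1Dcos s d0.
have [il el] := L1_laplace d0.
transitivity (rint (fun x => laplace d x * (1 + cos (s * x)) - laplace d x)).
  by apply: rint_eq => x; ring.
by rewrite rintB// e el; ring.
Qed.

Lemma rint_odd (h : R -> R) : L1 h -> (forall x, h (- x) = - h x) -> rint h = 0.
Proof.
move=> hi oh.
have : rint h = - rint h.
  rewrite {1}(rint_affine 0 (_ : -1 != 0 :> R) hi) ?oppr_eq0 ?oner_eq0//.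
  rewrite normrN1 mul1r -rintN//; apply: rint_eq => x.
  by rewrite addr0 mulN1r oh.
by lra.
Qed.

Lemma ifourier_laplace (d s : R) : 0 < d ->
  ifourier (fun x => (laplace d x)%:C) s =
  ((Num.sqrt (2 * pi))^-1 * (2 * d / (d ^+ 2 + s ^+ 2)))%:C.
Proof.
move=> d0; have [il _] := L1_laplace d0.
rewrite /ifourier rmorphM /=; congr (_ * _).
have ci := cintegrable_cisM s (cintegrableR il).
rewrite /cint; congr (_ +i* _).
  rewrite -(rint_laplace_cos s d0); apply: rint_eq => x /=.
  by rewrite mulr0 subr0 mulrC [s * x]mulrC.
apply: rint_odd; first exact: (proj2 ci).
move=> x /=; rewrite !mulr0 !add0r mulNr sinN.
by rewrite /laplace normrN mulNr.
Qed.

End PoissonKernel.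

(** * Fourier inversion *)

Section Inversion.
Context {R : realType}.
Local Notation mu := (@lebesgue_measure R).

Lemma rint_oneDsqrV : L1 (fun x : R => (1 + x ^+ 2)^-1) /\
  rint (fun x : R => (1 + x ^+ 2)^-1) = pi.
Proof.
have h0 (x : R) : 0 <= (1 + x ^+ 2)^-1.
  by rewrite invr_ge0 addr_ge0// sqr_ge0.
apply: ge0_integral_L1 => //.
  exact: (continuous_measurable_fun (@continuous_oneDsqrV R)).
rewrite ge0_symfun_integralT//.
- rewrite (_ : [set x | _] = `[0, +oo[%classic); last first.
    by apply/seteqP; split => x/=; rewrite in_itv/= andbT.
  by rewrite [X in (_ * X)%E](@integral0y_oneDsqr R) -EFinM mulrCA divff// mulr1.
- exact: continuous_oneDsqrV.
- by move=> x /=; rewrite sqrrN.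
Qed.

(** The Poisson kernel, which is the Fourier transform of [laplace d] up to
    normalization; its integral is [2 * pi] for every [d > 0]. *)
Definition poisson (d s : R) : R := 2 * d / (d ^+ 2 + s ^+ 2).

Lemma poisson_ge0 d s : 0 < d -> 0 <= poisson d s.
Proof.
move=> d0; rewrite /poisson divr_ge0 ?mulr_ge0 ?addr_ge0 ?sqr_ge0//.
exact: ltW.
Qed.

Lemma rint_poisson (d l : R) : 0 < d ->
  L1 (fun x => poisson d (x - l)) /\ rint (fun x => poisson d (x - l)) = 2 * pi.
Proof.
move=> d0; have [ki ke] := rint_oneDsqrV.
have d'0 : d^-1 != 0 by rewrite invr_eq0 gt_eqF.
have E : (fun x => poisson d (x - l)) =
    (fun x => 2 / d * (1 + (d^-1 * x + (- l / d)) ^+ 2)^-1).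
  apply/funext => x; rewrite /poisson; field.
  rewrite !gt_eqF ?mulr_gt0//=.
  - by rewrite ltr_pwDl ?sqr_ge0// exprn_gt0.
rewrite E; have ki' := L1_affine (- l / d) d'0 ki.
split; first exact: L1Zl.
rewrite rintZl//; have := rint_affine (- l / d) d'0 ki.
rewrite ke gtr0_norm ?invr_gt0// => ->.
by field; rewrite gt_eqF.
Qed.

(** The Poisson kernel is an approximate identity for continuous integrable
    functions. No bound on the function is needed: away from [l] the kernel is at most
    [2 * d / h ^+ 2], which suffices for an integrable function. *)
Lemma poisson_approx (U : R -> R[i]) (l e : R) : ccontinuous U -> cintegrable U ->
  0 < e -> exists C : R, forall d, 0 < d ->
    norm1 (cint (fun a => (U a - U l) * (poisson d (a - l))%:C)) <= e + d * C.
Proof.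
move=> [cU1 cU2] Ui e0.
have p0 : 0 < 2 * pi :> R by rewrite mulr_gt0 ?pi_gt0.
pose e1 := e / (2 * pi).
have e10 : 0 < e1 by rewrite divr_gt0.
have [h h0 Hh] : exists2 h : R, 0 < h &
    forall a, `|a - l| < h -> norm1 (U a - U l) <= e1.
  have e20 : 0 < e1 / 2 by rewrite divr_gt0.
  move/cvgrPdist_lt: (cU1 l) => /(_ _ e20) [h1 /= h10 H1].
  move/cvgrPdist_lt: (cU2 l) => /(_ _ e20) [h2 /= h20 H2].
  exists (Num.min h1 h2); first by rewrite lt_min h10.
  move=> a; rewrite lt_min distrC => /andP[a1 a2].
  have {H1} := H1 a a1; have {H2} := H2 a a2.
  rewrite /norm1; case: (U a) (U l) => a3 a4 [b3 b4] /=.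
  by rewrite distrC [`|b3 - a3|]distrC; lra.
have [ki ke] := rint_oneDsqrV.
have ki' : L1 (fun a => (1 + (a - l) ^+ 2)^-1).
  have := L1_affine (- l) (oner_neq0 _) ki.
  by under eq_fun do rewrite mul1r.
pose K := rint (fun a => (1 + (a - l) ^+ 2)^-1).
exists (2 / h ^+ 2 * rint (fun a => norm1 (U a)) + norm1 (U l) * (2 * (1 + h ^- 2)) * K).
move=> d d0.
have [pi' pe] := rint_poisson l d0.
have Un1 := L1_norm1 Ui.
pose G a := e1 * poisson d (a - l) + (d * (2 / h ^+ 2)) * norm1 (U a)
   + (d * (norm1 (U l) * (2 * (1 + h ^- 2)))) * (1 + (a - l) ^+ 2)^-1.
have G1 : L1 (fun a => e1 * poisson d (a - l)) by exact: L1Zl.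
have G2 : L1 (fun a => (d * (2 / h ^+ 2)) * norm1 (U a)) by exact: L1Zl.
have G3 : L1 (fun a => (d * (norm1 (U l) * (2 * (1 + h ^- 2)))) * (1 + (a - l) ^+ 2)^-1).
  exact: L1Zl.
have GL : L1 G by apply: L1D => //; apply: L1D.
(* Near [l] the oscillation of [U] is small; elsewhere the kernel is bounded both
   by a constant multiple of [d] and by [d] times a Cauchy density. *)
have FG a : norm1 ((U a - U l) * (poisson d (a - l))%:C) <= G a.
  apply: le_trans (norm1M _ _) _; rewrite norm1R ger0_norm ?poisson_ge0//.
  have q0 : 0 <= (1 + (a - l) ^+ 2)^-1 by rewrite invr_ge0 addr_ge0 ?sqr_ge0.
  have h2 : 0 <= h ^- 2 by rewrite invr_ge0 exprn_ge0// ltW.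
  have dl := ltW d0.
  have [ah|ha] := ltP `|a - l| h.
    rewrite /G -addrA ler_wpDr ?ler_wpM2r ?poisson_ge0 ?Hh//.
    by apply: addr_ge0; repeat apply: mulr_ge0 => //; rewrite ?norm1_ge0 ?addr_ge0.
  have s0 : 0 < (a - l) ^+ 2.
    by rewrite exprn_even_gt0//= -normr_gt0 (lt_le_trans h0 ha).
  have hs : h ^+ 2 <= (a - l) ^+ 2.
    by rewrite -[leRHS]real_normK ?num_real// lerXn2r ?nnegrE// ltW.
  have ps : poisson d (a - l) <= d * (2 / (a - l) ^+ 2).
    rewrite /poisson (mulrC 2) -mulrA ler_wpM2l ?(ltW d0)// ler_wpM2l//.
    rewrite lef_pV2 ?posrE// ?lerDr ?sqr_ge0//.
    by rewrite ltr_wpDl ?sqr_ge0.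
  have p1 : poisson d (a - l) <= d * (2 / h ^+ 2).
    apply: le_trans ps _; rewrite ler_wpM2l ?(ltW d0)// ler_wpM2l//.
    by rewrite lef_pV2 ?posrE// exprn_gt0.
  have p2 : poisson d (a - l) <= d * (2 * (1 + h ^- 2)) * (1 + (a - l) ^+ 2)^-1.
    apply: le_trans ps _; rewrite -!mulrA ler_wpM2l ?(ltW d0)// ler_wpM2l//.
    have q1 : 0 < 1 + (a - l) ^+ 2 by rewrite ltr_pwDl ?sqr_ge0.
    rewrite ler_pdivlMr//.
    rewrite mulrDr mulr1 mulVf ?gt_eqF// addrC lerD2l.
    by rewrite lef_pV2 ?posrE// exprn_gt0.
  have u1 := ler_wpM2l (norm1_ge0 (U a)) p1.
  have u2 := ler_wpM2l (norm1_ge0 (U l)) p2.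
  have u3 : norm1 (U a - U l) * poisson d (a - l) <=
      (norm1 (U a) + norm1 (U l)) * poisson d (a - l).
    apply: ler_wpM2r; first exact: poisson_ge0.
    by rewrite -(norm1N (U l)); exact: norm1D.
  have u4 : 0 <= e1 * poisson d (a - l) by rewrite mulr_ge0 ?poisson_ge0 ?ltW.
  apply: le_trans u3 _; rewrite mulrDl.
  apply: le_trans (lerD u1 u2) _.
  rewrite /G (mulrC (norm1 (U a))) -[leRHS]addrA ler_wpDl// lerD2l.
  by rewrite le_eqVlt; apply/orP; left; apply/eqP; ring.
have mF : cmeasurable (fun a => (U a - U l) * (poisson d (a - l))%:C).
  apply: cmeasurableM; last exact: (cmeasurableR (L1_measurable pi')).
  apply: cmeasurableD; first exact: cintegrable_cmeasurable.
  exact: cmeasurable_cst.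
have Fi := cintegrable_dom mF GL FG.
apply: le_trans (norm1_cint Fi) _.
apply: le_trans (rint_le (L1_norm1 Fi) GL FG) _.
rewrite /G rintD//; last exact: L1D.
rewrite rintD// (rintZl _ pi') (rintZl _ Un1) (rintZl _ ki') pe -/K.
rewrite le_eqVlt; apply/orP; left; apply/eqP.
rewrite divfK ?(gt_eqF p0)//; field.
by rewrite gt_eqF.
Qed.

(** Removing the summability factor, by dominated convergence. *)
Lemma cvg_rint_laplace (h : R -> R) : L1 h ->
  rint (fun x => (1 - laplace n.+1%:R^-1 x) * h x) @[n --> \oo] --> 0.
Proof.
move=> hi; have mh := L1_measurable hi.
have ml n : measurable_fun setT (laplace (n.+1%:R^-1 : R)).
  by apply: continuous_measurable_fun; exact: continuous_laplace.
have := @dominated_cvg _ _ R mu setT measurableT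
  (fun n x => ((1 - laplace n.+1%:R^-1 x) * h x)%:E)
  (fun=> 0%E) (fun x => `|h x|%:E).
have m1 n : measurable_fun setT (fun x => ((1 - laplace n.+1%:R^-1 x) * h x)%:E).
  apply/measurable_EFinP; apply: measurable_funM => //.
  exact: measurable_funB.
have c1 x : setT x -> ((1 - laplace n.+1%:R^-1 x) * h x)%:E @[n --> \oo] --> 0%E.
  move=> _; apply: cvg_EFin; first exact: nearW.
  have e1 : laplace (n.+1%:R^-1 : R) x @[n --> \oo] --> expR (- 0 * `|x|).
    apply: (@cvg_comp _ _ _ (fun n : nat => - (n.+1%:R^-1 : R) * `|x|) expR);
      last exact: continuous_expR.
    apply: cvgM; last exact: cvg_cst.
    by apply: cvgN; exact: cvg_harmonic.
  have e2 : (1 - laplace (n.+1%:R^-1 : R) x) * h x @[n --> \oo]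
      --> (1 - expR (- 0 * `|x|)) * h x.
    apply: cvgM; last exact: cvg_cst.
    by apply: cvgB; [exact: cvg_cst|exact: e1].
  by move: e2; rewrite oppr0 mul0r expR0 subrr mul0r.
have d1 n x : setT x -> (`|((1 - laplace n.+1%:R^-1 x) * h x)%:E| <= `|h x|%:E)%E.
  move=> _; rewrite lee_fin normrM ler_piMl// ger0_norm ?subr_ge0.
    by rewrite lerBlDr lerDl expR_ge0.
  by rewrite -expR0 ler_expR mulNr oppr_le0 mulr_ge0.
move=> /(_ m1 c1 (fun x _ => isT) (L1norm hi) d1).
rewrite integral0 => /fine_cvg; exact.
Qed.

(** Fourier inversion for a continuous integrable function whose transform is
    integrable, by Abel summation of the inversion integral. *)
Theorem fourier_inversion (U : R -> R[i]) : ccontinuous U -> cintegrable U ->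
  cintegrable (ifourier U) -> fourier (ifourier U) = U.
Proof.
move=> cU Ui ui; apply/funext => l.
set u := ifourier U in ui *.
pose s : R := Num.sqrt (2 * pi).
have s0 : 0 < s by exact: sqrt2pi_gt0.
have ss : s * s = 2 * pi by rewrite -expr2 sqr_sqrtr// mulr_ge0 ?pi_ge0.
pose T (d : R) := cint (fun x => cis (x * - l) * (laplace d x)%:C * u x).
pose P (d : R) := cint (fun a => (U a - U l) * (poisson d (a - l))%:C).
(* [T d] is the regularized inversion integral, and [P d] its Poisson error. *)
have TP d : 0 < d -> T d = s%:C * U l + (s^-1)%:C * P d.
  move=> d0; have [li _] := L1_laplace d0.
  have [pli ple] := rint_poisson l d0.
  have E a : U a * ifourier (fun x => (laplace d x)%:C) (- l + 1 * a) =
      (s^-1)%:C * (U a * (poisson d (a - l))%:C).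
    rewrite (ifourier_laplace _ d0) [1 * a]mul1r (addrC (- l)) -/s -/(poisson d (a - l)) rmorphM /=.
    by rewrite mulrCA.
  have i0 : cintegrable (fun a => U l * (poisson d (a - l))%:C).
    exact/cintegrableZ/cintegrableR.
  have i1 : cintegrable (fun a => U a * (poisson d (a - l))%:C).
    have [+ _ _] := ifourier_pairing (- l) 1 Ui (cintegrableR li).
    rewrite (funext E) => /(cintegrableZ s%:C).
    under eq_fun do rewrite mulrA -rmorphM /= divff ?gt_eqF// mul1r.
    exact.
  have i2 : cintegrable (fun a => (U a - U l) * (poisson d (a - l))%:C).
    have := cintegrableD i1 (cintegrableZ (-1) i0).
    by under eq_fun do rewrite mulN1r -mulrBl.
  have [_ _ Tp] := ifourier_pairing (- l) 1 Ui (cintegrableR li).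
  have Te : T d = cint (fun x => cis (x * - l) * (laplace d x)%:C * ifourier U (1 * x)).
    by apply: cint_eq => x; rewrite [1 * x]mul1r.
  rewrite Te -Tp {Te Tp}.
  rewrite (cint_eq E) cintZ//.
  transitivity ((s^-1)%:C * cint (fun a => (U a - U l) * (poisson d (a - l))%:C
      + U l * (poisson d (a - l))%:C)).
    by congr (_ * _); apply: cint_eq => a; rewrite -mulrDl subrK.
  rewrite cintD// -/(P d) mulrDr addrC; congr (_ + _).
  rewrite cintZ; last exact: cintegrableR.
  rewrite cintR ple -ss mulrCA -rmorphM /= mulrA mulVf ?gt_eqF// mul1r.
  exact: mulrC.
have FT d : 0 < d ->
    norm1 (s%:C * fourier u l - T d) <= 2 * rint (fun x => (1 - laplace d x) * norm1 (u x)).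
  move=> d0.
  have l1 x : laplace d x <= 1.
    by rewrite -expR0 ler_expR mulNr oppr_le0 mulr_ge0// ltW.
  have ml : measurable_fun setT (laplace d).
    by apply: continuous_measurable_fun; exact: continuous_laplace.
  have j1 : cintegrable (fun x => (laplace d x)%:C * u x).
    apply: (cintegrable_bounded (C := 1) ui); first exact: cmeasurableR.
    by move=> x; rewrite norm1R ger0_norm// expR_ge0.
  have j2 : cintegrable (fun x => (1 - laplace d x)%:C * u x).
    apply: (cintegrable_bounded (C := 1) ui); first exact/cmeasurableR/measurable_funB.
    move=> x; rewrite norm1R ger0_norm// ?subr_ge0//.
    by rewrite lerBlDr lerDl expR_ge0.
  have -> : s%:C * fourier u l - T d =
      cint (fun x => cis (x * - l) * ((1 - laplace d x)%:C * u x)).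
    rewrite fourier_ifourier -cint_cis_ifourier// /T -[- cint _]mulN1r -cintZ; last first.
      have := cintegrable_cisM (- l) j1.
      by under eq_fun do rewrite mulrA.
    rewrite -cintD; last 2 first.
    - exact: cintegrable_cisM.
    - apply: cintegrableZ; have := cintegrable_cisM (- l) j1.
      by under eq_fun do rewrite mulrA.
    apply: cint_eq => x; rewrite rmorphB /=; ring.
  apply: le_trans (norm1_cint (cintegrable_cisM _ j2)) _.
  have k1 : L1 (fun x => (1 - laplace d x) * norm1 (u x)).
    apply: (L1_dom _ (L1_norm1 ui)).
      apply: measurable_funM; first exact: measurable_funB.
      exact/measurable_norm1/cintegrable_cmeasurable.
    move=> x; rewrite normrM (ger0_norm (norm1_ge0 _)) ler_piMl ?norm1_ge0//.
    by rewrite ger0_norm ?subr_ge0// lerBlDr lerDl expR_ge0.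
  rewrite -rintZl//; apply: rint_le; [exact/L1_norm1/cintegrable_cisM|exact: L1Zl|].
  move=> x; apply: le_trans (norm1M _ _) _; apply: ler_pM; rewrite ?norm1_ge0 ?norm1_cis//.
  apply: le_trans (norm1M _ _) _; rewrite norm1R ger0_norm// subr_ge0.
  exact: l1.
have main e : 0 < e -> norm1 (s%:C * (fourier u l - U l)) <= s^-1 * e.
  move=> e0; have [C HC] := poisson_approx l cU Ui e0.
  have bound (n : nat) : norm1 (s%:C * (fourier u l - U l)) <=
      2 * rint (fun x => (1 - laplace n.+1%:R^-1 x) * norm1 (u x))
      + s^-1 * (e + n.+1%:R^-1 * C).
    have d0 : 0 < n.+1%:R^-1 :> R by rewrite invr_gt0.
    have -> : s%:C * (fourier u l - U l) =
        (s%:C * fourier u l - T n.+1%:R^-1) + (s^-1)%:C * P n.+1%:R^-1.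
      by rewrite TP//; ring.
    apply: le_trans (norm1D _ _) _; apply: lerD; first exact: FT.
    apply: le_trans (norm1M _ _) _; rewrite norm1R ger0_norm ?invr_ge0 ?(ltW s0)//.
    by apply: ler_wpM2l; [rewrite invr_ge0 ltW|exact: HC].
  have lim : (2 * rint (fun x => (1 - laplace n.+1%:R^-1 x) * norm1 (u x))
      + s^-1 * (e + n.+1%:R^-1 * C)) @[n --> \oo] --> 2 * 0 + s^-1 * (e + 0 * C).
    apply: cvgD.
      by apply: cvgM; [exact: cvg_cst|exact/cvg_rint_laplace/L1_norm1].
    apply: cvgM; first exact: cvg_cst.
    apply: cvgD; first exact: cvg_cst.
    by apply: cvgM; [exact: cvg_harmonic|exact: cvg_cst].
  have := @cvgr_to_ge _ _ _ _ _ _ _ lim.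
  rewrite mulr0 mul0r addr0 add0r; apply.
  exact: nearW.
have z0 : norm1 (s%:C * (fourier u l - U l)) = 0.
  apply/eqP; rewrite eq_le norm1_ge0 andbT; apply/ler_addgt0Pr => e e0.
  rewrite add0r (le_trans (main (s * e) _)) ?mulr_gt0//.
  by rewrite mulrA mulVf ?gt_eqF// mul1r.
have /eqP := norm1_eq0 z0; rewrite mulf_eq0 => /orP[/eqP/(congr1 (@complex.Re _)) /= s00|].
  by move: s0; rewrite s00 ltxx.
by rewrite subr_eq0 => /eqP.
Qed.

End Inversion.

(** * Derivative of an inverse transform *)

Section Derivative.
Context {R : realType}.
Local Notation mu := (@lebesgue_measure R).
Local Notation c := ((Num.sqrt (2 * pi))^-1 : R).

(** Differentiation under the integral sign, with a global dominating function. *)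
Lemma derive1_rint (f df : R -> R -> R) (G : R -> R) (a : R) :
  (forall x, L1 (f x)) ->
  (forall x y : R, is_derive x 1 (fun z : R => f z y) (df x y)) ->
  L1 G -> (forall x y, `|df x y| <= G y) ->
  derive1 (fun x => rint (f x)) a = rint (df a).
Proof.
move=> fi fdf Gi dfG.
have E x y : partial1of2 f x y = df x y.
  by rewrite partial1of2E; exact: (@derive_val _ _ _ _ _ _ _ (fdf x y)).
have Ia : [set` `]a - 1, a + 1[] a.
  by rewrite /= in_itv/= ltrBlDr ltrDl ltr01.
have := @differentiation_under_integral R _ _ mu f setT measurableT a (a - 1) (a + 1)
  Ia (fun x _ => fi x) _ G _ Gi _.
rewrite /rint => ->.
- by apply: eq_Rintegral => y _; exact: E.
- by move=> x y _ _; exact: (@ex_derive _ _ _ _ _ _ _ (fdf x y)).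
- by move=> y; exact: le_trans (normr_ge0 _) (dfG a y).
- by move=> x y _ _; rewrite E.
Qed.

Lemma is_derive_cis_comb (a p q x : R) :
  is_derive x 1 (fun y => cos (a * y) * p + sin (a * y) * q)
    (a * (cos (a * x) * q - sin (a * x) * p)).
Proof.
have hS := is_derive1_comp (is_derive_sin (a * x)) (is_derive_scale a x).
have hC := is_derive1_comp (is_derive_cos (a * x)) (is_derive_scale a x).
have H := is_deriveD (is_deriveM hC (is_derive_cst p x (1 : R)))
  (is_deriveM hS (is_derive_cst q x (1 : R))).
apply: is_derive_eq H _.
rewrite !fctE ![_ *: _]/(_ * _).
have aux (s k : R) : k * 0 + p * (- s * a) + (s * 0 + q * (k * a)) =
  a * (k * q - s * p) by ring.
exact: aux.
Qed.

(** The derivative of an inverse transform is the inverse transform of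
    [i * l * f l]. *)
Lemma cderive_ifourier (f : R -> R[i]) (x : R) : cintegrable f ->
  cintegrable (fun l => l%:C * f l) ->
  cderive (ifourier f) x = 'i%C * ifourier (fun l => l%:C * f l) x.
Proof.
move=> fi lfi.
have [f1 f2] := fi.
have ci y := cintegrable_cisM y fi.
have G1 : L1 (fun l => c * norm1 (l%:C * f l)) by exact/L1Zl/L1_norm1.
have c0 : 0 <= c by rewrite invr_ge0 sqrtr_ge0.
have lin (k : R) y : `|k * (cos (k * y) * complex.Im (f k) + sin (k * y) * complex.Re (f k))|
    <= norm1 (k%:C * f k) /\
    `|k * (cos (k * y) * complex.Re (f k) - sin (k * y) * complex.Im (f k))|
    <= norm1 (k%:C * f k).
  have E : norm1 (k%:C * f k) = `|k| * (`|complex.Re (f k)| + `|complex.Im (f k)|).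
    rewrite /norm1; case: (f k) => p q /=.
    by rewrite !mul0r subr0 addr0 !normrM -mulrDr.
  rewrite E !normrM; split; apply: ler_wpM2l => //.
  - rewrite (le_trans (ler_normD _ _))// !normrM addrC lerD// ler_piMl//.
    + exact: sin_max.
    + exact: cos_max.
  - rewrite (le_trans (ler_normB _ _))// !normrM lerD// ler_piMl//.
    + exact: cos_max.
    + exact: sin_max.
have D1 : derive1 (fun y => complex.Re (ifourier f y)) x =
    rint (fun l => c * (l * (cos (l * x) * - complex.Im (f l) - sin (l * x) * complex.Re (f l)))).
  rewrite (_ : (fun y => complex.Re (ifourier f y)) = fun y => rint (fun l =>
      c * (cos (l * y) * complex.Re (f l) + sin (l * y) * - complex.Im (f l)))); last first.
    apply/funext => y; rewrite /ifourier /= mul0r subr0 -rintZl; last exact: (proj1 (ci y)).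
    apply: rint_eq => l; case: (f l) => p q /=.
    by rewrite mulrN.
  apply: (@derive1_rint
    (fun y l => c * (cos (l * y) * complex.Re (f l) + sin (l * y) * - complex.Im (f l)))
    (fun y l => c * (l * (cos (l * y) * - complex.Im (f l) - sin (l * y) * complex.Re (f l))))
    (fun l => c * norm1 (l%:C * f l))) => //.
  - move=> y; apply: L1Zl; have := proj1 (ci y).
    apply: eq_integrable => // l _ /=; case: (f l) => p q /=.
    by rewrite mulrN.
  - move=> y l.
    have := is_deriveZ c (is_derive_cis_comb l (complex.Re (f l)) (- complex.Im (f l)) y).
    by [].
  - move=> y l; rewrite normrM ger0_norm// ler_wpM2l//.
    rewrite mulrN -opprD mulrN normrN.
    by have [] := lin l y.
have D2 : derive1 (fun y => complex.Im (ifourier f y)) x =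
    rint (fun l => c * (l * (cos (l * x) * complex.Re (f l) - sin (l * x) * complex.Im (f l)))).
  rewrite (_ : (fun y => complex.Im (ifourier f y)) = fun y => rint (fun l =>
      c * (cos (l * y) * complex.Im (f l) + sin (l * y) * complex.Re (f l)))); last first.
    apply/funext => y; rewrite /ifourier /= mul0r addr0 -rintZl; last exact: (proj2 (ci y)).
    by apply: rint_eq => l; case: (f l) => p q /=.
  apply: (@derive1_rint
    (fun y l => c * (cos (l * y) * complex.Im (f l) + sin (l * y) * complex.Re (f l)))
    (fun y l => c * (l * (cos (l * y) * complex.Re (f l) - sin (l * y) * complex.Im (f l))))
    (fun l => c * norm1 (l%:C * f l))) => //.
  - move=> y; apply: L1Zl; have := proj2 (ci y).
    by apply: eq_integrable => // l _ /=; case: (f l) => p q /=.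
  - move=> y l.
    exact: (is_deriveZ c (is_derive_cis_comb l (complex.Im (f l)) (complex.Re (f l)) y)).
  - move=> y l; rewrite normrM ger0_norm// ler_wpM2l//.
    by have [] := lin l y.
rewrite /cderive D1 D2 -ifourierZ// /ifourier.
have [h1 h2] := cintegrable_cisM x (cintegrableZ 'i%C lfi).
rewrite /cint; simpc; rewrite -!rintZl//.
congr (_ +i* _); apply: rint_eq => l; case: (f l) => p q /=; ring.
Qed.

End Derivative.

(** * Iterated quartic integrals *)

Section Triple.
Context {R : realType}.
Implicit Types (F G : R -> R -> R -> R[i]).
Local Notation s2pi := (Num.sqrt (2 * pi) : R).

(** Iterated triple integral, in the order used by [quartic_int]. *)
Definition cint3 F : R[i] := cint (fun a => cint (fun b => cint (F a b))).

(** Integrability at each of the three stages of the iterated integral; this is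
    what linearity of [cint3] requires. *)
Definition cintegrable3 F : Prop :=
  [/\ forall a b, cintegrable (F a b),
      forall a, cintegrable (fun b => cint (F a b)) &
      cintegrable (fun a => cint (fun b => cint (F a b)))].

Lemma eq_fun3 F G : (forall a b c, F a b c = G a b c) -> F = G.
Proof. by move=> FG; do 3 (apply/funext => ?); exact: FG. Qed.

Lemma cintegrable3D F G : cintegrable3 F -> cintegrable3 G ->
  cintegrable3 (fun a b c => F a b c + G a b c) /\
  cint3 (fun a b c => F a b c + G a b c) = cint3 F + cint3 G.
Proof.
move=> [F1 F2 F3] [G1 G2 G3].
have e1 a b : cint (fun c => F a b c + G a b c) = cint (F a b) + cint (G a b).
  by rewrite cintD.
have e2 a : cint (fun b => cint (fun c => F a b c + G a b c)) =
    cint (fun b => cint (F a b)) + cint (fun b => cint (G a b)).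
  by rewrite (funext (e1 a)) cintD.
split; first split.
- by move=> a b; exact: cintegrableD.
- by move=> a; rewrite (funext (e1 a)); exact: cintegrableD.
- by rewrite (funext e2); exact: cintegrableD.
exact: (etrans (congr1 cint (funext e2)) (cintD F3 G3)).
Qed.

Lemma cintegrable3Z z F : cintegrable3 F ->
  cintegrable3 (fun a b c => z * F a b c) /\
  cint3 (fun a b c => z * F a b c) = z * cint3 F.
Proof.
move=> [F1 F2 F3].
have e1 a b : cint (fun c => z * F a b c) = z * cint (F a b) by rewrite cintZ.
have e2 a : cint (fun b => cint (fun c => z * F a b c)) =
    z * cint (fun b => cint (F a b)).
  by rewrite (funext (e1 a)) cintZ.
split; first split.
- by move=> a b; exact: cintegrableZ.
- by move=> a; rewrite (funext (e1 a)); exact: cintegrableZ.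
- by rewrite (funext e2); exact: cintegrableZ.
exact: (etrans (congr1 cint (funext e2)) (cintZ z F3)).
Qed.

Lemma ifourier_pairing0 (f v : R -> R[i]) : cintegrable f -> cintegrable v ->
  [/\ cintegrable (fun l => f l * ifourier v l),
      cintegrable (fun x => v x * ifourier f x) &
      cint (fun l => f l * ifourier v l) = cint (fun x => v x * ifourier f x)].
Proof.
move=> fi vi; have [] := ifourier_pairing 0 1 fi vi.
have e1 : (fun l => f l * ifourier v (0 + 1 * l)) = (fun l => f l * ifourier v l).
  by apply/funext => l; rewrite [1 * l]mul1r [0 + l]add0r.
have e2 : (fun x => cis (x * 0) * v x * ifourier f (1 * x)) =
    (fun x => v x * ifourier f x).
  by apply/funext => x; rewrite [1 * x]mul1r [x * 0]mulr0 cis0 [1 * v x]mul1r.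
rewrite e1 e2 => h1 h2 h3; split; [exact: h1|exact: h2|exact: h3].
Qed.

(** Quartic form with a separable kernel. The fourth factor is an inverse
    transform evaluated at [a + b - c]; three applications of the pairing, for
    [c], then [b], then [a], turn the integral over the resonant set into the
    integral of a product of four functions of position. *)
Lemma cint3_separable (f1 f2 f3 v : R -> R[i]) :
  cintegrable f1 -> cintegrable f2 -> cintegrable f3 -> cintegrable v ->
  let g x := v x * fourier f3 x * ifourier f2 x * ifourier f1 x in
  let F a b c := f1 a * f2 b * (f3 c * ifourier v (a + b - c)) in
  [/\ cintegrable g, cintegrable3 F & cint3 F = (2 * pi)%:C * cint g].
Proof.
move=> i1 i2 i3 iv g F.
pose v1 x := v x * fourier f3 x.
have v1E : v1 = fun x => v x * ifourier f3 (- 1 * x).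
  by apply/funext => x; rewrite /v1 fourier_ifourier mulN1r.
have v1i : cintegrable v1 by rewrite v1E; exact: cintegrable_mul_ifourier.
pose v2 x := v1 x * ifourier f2 x.
have v2E : v2 = fun x => v1 x * ifourier f2 (1 * x).
  by apply/funext => x; rewrite /v2 [1 * x]mul1r.
have v2i : cintegrable v2 by rewrite v2E; exact: cintegrable_mul_ifourier.
have [p1 p2 p3] := ifourier_pairing0 i1 v2i.
have FE a b : F a b = fun c => f1 a * f2 b * (f3 c * ifourier v ((a + b) + - 1 * c)).
  by apply/funext => c; rewrite /F [- 1 * c]mulN1r.
have e1 a b : cint (F a b) = s2pi%:C * f1 a * (f2 b * ifourier v1 (a + 1 * b)).
  have [q1 _ _] := ifourier_pairing (a + b) (- 1) i3 iv.
  rewrite FE (cintZ _ q1) (cint_mul_ifourier _ _ i3 iv) -v1E [1 * b]mul1r.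
  ring.
have e2 a : cint (fun b => cint (F a b)) = (2 * pi)%:C * (f1 a * ifourier v2 a).
  have [q1 _ _] := ifourier_pairing a 1 i2 v1i.
  rewrite (funext (e1 a)) (cintZ _ q1) (cint_mul_ifourier _ _ i2 v1i) -v2E.
  rewrite -sqrt2pi_sq; ring.
split; first exact: p2.
- split.
  + move=> a b; rewrite FE; apply: cintegrableZ.
    have [q1 _ _] := ifourier_pairing (a + b) (- 1) i3 iv; exact: q1.
  + move=> a; rewrite (funext (e1 a)); apply: cintegrableZ.
    have [q1 _ _] := ifourier_pairing a 1 i2 v1i; exact: q1.
  + by rewrite (funext e2); exact: (cintegrableZ _ p1).
apply: (etrans (congr1 cint (funext e2))).
by rewrite (cintZ _ p1) p3.
Qed.

End Triple.

(** * Regular profiles *)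

Section Profile.
Context {R : realType}.
Variable U : R -> R[i].
Hypothesis hU : regular_profile U.
Local Notation u := (ifourier U).
Local Notation s2pi := (Num.sqrt (2 * pi) : R).
Implicit Types (k : R -> R[i]).

Let ub x := (u x)^*%C.
Let weight (l : R) := 1 + `|l|.
Let iw : cintegrable (fun l => (weight l)%:C * U l).
Proof. by have [] := hU. Qed.

Let weight_ge1 l : 1 <= weight l.
Proof. by rewrite lerDl. Qed.

Let weight_ge0 l : 0 <= weight l.
Proof. exact: le_trans (weight_ge1 l). Qed.

Let mU : cmeasurable U.
Proof. by have [/ccontinuous_cmeasurable] := hU. Qed.

Lemma L1_weight : L1 (fun l => (1 + `|l|) * norm1 (U l)).
Proof.
have := L1_norm1 iw; apply: eq_integrable => // l _ /=.
congr EFin; rewrite /norm1; case: (U l) => p q /=.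
by rewrite !mul0r subr0 addr0 !normrM -mulrDr (ger0_norm (weight_ge0 l)).
Qed.

Lemma cintegrable_weighted (m : R -> R) (C : R) : measurable_fun setT m ->
  (forall l, `|m l| <= C * (1 + `|l|)) -> cintegrable (fun l => (m l)%:C * U l).
Proof.
move=> mm mC; apply: (cintegrable_dom (g := fun l => C * ((1 + `|l|) * norm1 (U l)))).
- by apply: cmeasurableM => //; exact: cmeasurableR.
- by apply: L1Zl; exact: L1_weight.
- move=> l; rewrite (le_trans (norm1M _ _))// norm1R mulrA ler_wpM2r ?norm1_ge0//.
Qed.

Lemma cintegrable_profile : cintegrable U.
Proof.
have := @cintegrable_weighted (fun=> 1) 1 (measurable_cst _) _.
under eq_fun do rewrite [1 * _]mul1r.
by apply => l; rewrite normr1 mul1r lerDl.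
Qed.

Lemma cintegrable_idM : cintegrable (fun l => l%:C * U l).
Proof.
apply: (cintegrable_weighted (C := 1)) => // l.
by rewrite mul1r lerDr.
Qed.

Lemma cintegrable_ifourier_profile : cintegrable u.
Proof. by have [] := hU. Qed.

Let ui := cintegrable_ifourier_profile.
Let Ui := cintegrable_profile.

Let ubi : cintegrable ub.
Proof. exact: cintegrableJ. Qed.

Lemma fourier_ifourier_profile : fourier u = U.
Proof. by have [cU _ _] := hU; exact: fourier_inversion. Qed.

(** By Fourier inversion the conjugate of the profile is an inverse transform. *)
Lemma conj_profile l : (U l)^*%C = ifourier (fun x => (u x)^*%C) l.
Proof.
rewrite -{1}fourier_ifourier_profile fourier_ifourier ifourierJ//.
by rewrite opprK.
Qed.

Lemma profile_bounded : exists M : R, forall l, norm1 (U l) <= M.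
Proof.
eexists => l; rewrite -norm1J conj_profile.
exact: norm1_ifourier.
Qed.

End Profile.

(** * The local quartic terms *)

Section Quartic.
Context {R : realType}.
Variable U : R -> R[i].
Hypothesis hU : regular_profile U.
Local Notation u := (ifourier U).
Local Notation s2pi := (Num.sqrt (2 * pi) : R).

Let ub x := (u x)^*%C.
Let Ui := cintegrable_profile hU.
Let lUi := cintegrable_idM hU.
Let ui := cintegrable_ifourier_profile hU.
Let ubi : cintegrable ub := cintegrableJ ui.
Let p := ifourier (fun l => l%:C * U l).

Lemma sqr_cabs (z : R[i]) : cabs z ^+ 2 = complex.Re z ^+ 2 + complex.Im z ^+ 2.
Proof.
by case: z => a b; rewrite /cabs /= sqr_sqrtr// addr_ge0// sqr_ge0.
Qed.

Lemma fourier_conj (f : R -> R[i]) x : cintegrable f ->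
  fourier (fun l => (f l)^*%C) x = (ifourier f x)^*%C.
Proof. by move=> fi; rewrite fourier_ifourier ifourierJ. Qed.

(** The kernel [1] gives the local quartic term. *)
Lemma quartic_int_const :
  cintegrable3 (fun a b c => (1 : R)%:C *
    (U a * U b * (U c)^*%C * (U (a + b - c))^*%C)) /\
  quartic_int (fun _ _ _ => 1) U = (2 * pi * rint (fun x => cabs (u x) ^+ 4))%:C.
Proof.
have [gi Fi e] := cint3_separable Ui Ui (cintegrableJ Ui) ubi.
have E : (fun a b c => (1 : R)%:C * (U a * U b * (U c)^*%C * (U (a + b - c))^*%C))
  = (fun a b c => U a * U b * ((U c)^*%C * ifourier ub (a + b - c))).
  apply: eq_fun3 => a b c; rewrite (conj_profile hU (a + b - c)).
  by rewrite [1%:C * _]mul1r; ring.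
split; first by rewrite E; exact: Fi.
rewrite /quartic_int -[LHS]/(cint3 _) E e [RHS]rmorphM; congr (_ * _).
transitivity (cint (fun x => (cabs (u x) ^+ 4)%:C)); last exact: cintR.
apply: cint_eq => x.
rewrite fourier_conj// /ub (_ : 4 = 2 * 2)%N// exprM sqr_cabs.
by case: (u x) => a b; simpc; congr (_ +i* _) => /=; ring.
Qed.

(** The kernel [l2 + l3] gives the current term: [l2] and [l3] put a derivative
    on one factor [u] and on one factor of its conjugate, and the two
    contributions add up to twice a real part. *)
Lemma quartic_int_add :
  cintegrable3 (fun a b c => (b + c)%:C *
    (U a * U b * (U c)^*%C * (U (a + b - c))^*%C)) /\
  quartic_int (fun a b c => b + c) U =
    (4 * pi * rint (fun x => cabs (u x) ^+ 2 *
       complex.Im ((u x)^*%C * cderive u x)))%:C.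
Proof.
have [gi Fi e] := cint3_separable Ui lUi (cintegrableJ Ui) ubi.
have [gi' Fi' e'] := cint3_separable Ui Ui (cintegrableJ lUi) ubi.
have [Si Se] := cintegrable3D Fi Fi'.
have E : (fun a b c => (b + c)%:C * (U a * U b * (U c)^*%C * (U (a + b - c))^*%C))
  = (fun a b c => U a * (b%:C * U b) * ((U c)^*%C * ifourier ub (a + b - c))
     + U a * U b * ((c%:C * U c)^*%C * ifourier ub (a + b - c))).
  apply: eq_fun3 => a b c; rewrite (conj_profile hU (a + b - c)) conjcM conjcR rmorphD /=.
  ring.
split; first by rewrite E; exact: Si.
rewrite /quartic_int -[LHS]/(cint3 _) E Se e e' -mulrDr -(cintD gi gi').
pose h x := cabs (u x) ^+ 2 * complex.Im ((u x)^*%C * cderive u x).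
have hE x : ub x * fourier (fun c => (U c)^*%C) x * ifourier (fun l => l%:C * U l) x
     * u x + ub x * fourier (fun c => (c%:C * U c)^*%C) x * u x * u x
     = (2 * h x)%:C.
  rewrite (fourier_conj _ Ui) (fourier_conj _ lUi) /ub /h.
  rewrite (cderive_ifourier x Ui lUi) sqr_cabs.
  case: (u x) (ifourier (fun l => l%:C * U l) x) => a b [c d].
  by simpc; congr (_ +i* _) => /=; ring.
have hi : L1 h.
  have h2 : L1 (fun x => 2 * h x).
    exact: (proj1 (eq_ind _ cintegrable (cintegrableD gi gi') _ (funext hE))).
  rewrite (_ : h = fun x => 2^-1 * (2 * h x)); first exact: L1Zl.
  by apply/funext => x; rewrite mulKf.
rewrite (cint_eq hE) cintR (rintZl _ hi) -rmorphM /=.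
by congr (_%:C); rewrite -/h; ring.
Qed.

End Quartic.

(** * The nonlocal quartic term *)

Section Nonlocal.
Context {R : realType}.

(** An inverse transform is measurable, since its product with the positive
    function [laplace 1] is integrable. *)
Lemma cmeasurable_ifourier (f : R -> R[i]) : cintegrable f -> cmeasurable (ifourier f).
Proof.
move=> fi; have [li _] := L1_laplace (@ltr01 R).
have [_ h _] := ifourier_pairing0 fi (cintegrableR li).
have mh := cintegrable_cmeasurable h.
have mE : measurable_fun setT (fun x : R => (laplace 1 x)^-1).
  rewrite (_ : (fun x => _) = (fun x : R => expR `|x|)).
    apply: measurableT_comp => //; exact: measurable_expR.
  by apply/funext => x; rewrite /laplace mulN1r expRN invrK.
have := cmeasurableM (cmeasurableR mE) mh.
rewrite (_ : (fun x => _ * _) = ifourier f)//.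
apply/funext => x; rewrite mulrA -rmorphM /= mulVf ?mul1r//.
by rewrite gt_eqF// expR_gt0.
Qed.

Variable U : R -> R[i].
Hypothesis hU : regular_profile U.
Local Notation u := (ifourier U).
Local Notation s2pi := (Num.sqrt (2 * pi) : R).

Let ub x := (u x)^*%C.
Let Ui := cintegrable_profile hU.
Let ui := cintegrable_ifourier_profile hU.
Let ubi : cintegrable ub := cintegrableJ ui.
Let mU : cmeasurable U := cintegrable_cmeasurable Ui.
Let w x : R[i] := (cabs (u x) ^+ 2)%:C.
Let W := ifourier w.

Let wE x : w x = ub x * u x.
Proof.
rewrite /w sqr_cabs /ub; case: (u x) => a b; simpc.
by congr (_ +i* _) => /=; ring.
Qed.

Let wi : cintegrable w.
Proof.
have [_ h _] := ifourier_pairing0 Ui ubi.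
by rewrite (funext wE); exact: h.
Qed.

Let Wbnd x : norm1 (W x) <= s2pi^-1 * (2 * rint (fun l => norm1 (w l))).
Proof. exact: norm1_ifourier. Qed.

(** Up to the factor [sqrt (2 * pi)], the autocorrelation of the profile is the
    inverse transform of [|u|^2]. *)
Let autocorrelation (s : R) : cintegrable (fun b => U b * (U (s + b))^*%C) /\
  cint (fun b => U b * (U (s + b))^*%C) = s2pi%:C * W s.
Proof.
have [h _ _] := ifourier_pairing s 1 Ui ubi.
have e := cint_mul_ifourier s 1 Ui ubi.
have E1 : (fun b => U b * (U (s + b))^*%C) = (fun l => U l * ifourier ub (s + 1 * l)).
  by apply/funext => b; rewrite (conj_profile hU (s + b)) [1 * b]mul1r.
have E2 : (fun x => ub x * u (1 * x)) = w.
  by apply/funext => x; rewrite wE [1 * x]mul1r.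
by rewrite E2 in e; rewrite E1.
Qed.

Lemma abs_weight (a l : R) : `|l| <= (1 + `|a|) * (1 + `|a - l|).
Proof.
have h := ler_normB a (a - l).
rewrite opprB addrCA subrr addr0 in h.
have h2 : 0 <= `|a| * `|a - l| by rewrite mulr_ge0.
by nra.
Qed.

(** Weighted exchange of the integrals over the frequency [a] and the frequency
    transfer [l]. The weight [|l|] is absorbed by the moments of both factors
    through [abs_weight]. *)
Lemma autocorrelation_fubini (k : R -> R[i]) (M : R) :
  cmeasurable k -> (forall x, norm1 (k x) <= M) ->
  let F a l := (`|l|%:C * k l) * (U a * (U (a - l))^*%C) in
  [/\ cintegrable (fun a => cint (F a)),
      cintegrable (fun l => cint (fun a => F a l)) &
      cint (fun a => cint (F a)) = cint (fun l => cint (fun a => F a l))].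
Proof.
move=> mk kM F.
have L := L1_weight hU.
have m1 : measurable_fun setT (fun z : R * R => z.1) by exact: measurable_fst.
have m2 : measurable_fun setT (fun z : R * R => z.2) by exact: measurable_snd.
have mF : cmeasurable (fun z : R * R => F z.1 z.2).
  apply: cmeasurableM; apply: cmeasurableM.
  - by apply: cmeasurableR; apply: measurableT_comp.
  - exact: (cmeasurable_comp mk m2).
  - exact: (cmeasurable_comp mU m1).
  - apply: cmeasurableJ; apply: (cmeasurable_comp mU); exact: measurable_funB.
have M0 : 0 <= M := le_trans (norm1_ge0 (k 0)) (kM 0).
have [] := cint_fubini mF (L1pair_conv (L1Zl M L) L).
- move=> [a l]; rewrite /F /=.
  apply: le_trans (norm1M _ _) _.
  apply: le_trans (ler_pM (norm1_ge0 _) (norm1_ge0 _) (norm1M _ _) (norm1M _ _)) _.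
  rewrite norm1R norm1J normr_id.
  have h1 := ler_pM (normr_ge0 l) (norm1_ge0 (k l)) (abs_weight a l) (kM l).
  have h2 : 0 <= norm1 (U a) * norm1 (U (a - l)) by rewrite mulr_ge0 ?norm1_ge0.
  apply: le_trans (ler_wpM2r h2 h1) _.
  by rewrite le_eqVlt; apply/orP; left; apply/eqP; ring.
move=> h1 h2 h3; split; [exact: h1|exact: h2|exact: h3].
Qed.

(** The kernel [|l1 - l3|] gives the nonlocal term. It depends only on the
    frequency transfer [l = l1 - l3]; integrating over the two other variables
    leaves [|l|] times the product of the transforms of [|u|^2] at [l] and
    [- l]. *)
Lemma quartic_int_abs :
  cintegrable3 (fun a b c => `|a - c|%:C *
    (U a * U b * (U c)^*%C * (U (a + b - c))^*%C)) /\
  quartic_int (fun a b c => `|a - c|) U =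
    (2 * pi)%:C * cint (fun x => (cabs (u x) ^+ 2)%:C
      * multiplier (fun l => `|l|) (fun y => (cabs (u y) ^+ 2)%:C) x).
Proof.
pose F a b c := `|a - c|%:C * (U a * U b * (U c)^*%C * (U (a + b - c))^*%C).
have [M HM] := profile_bounded hU.
have M0 : 0 <= M := le_trans (norm1_ge0 (U 0)) (HM 0).
have L := L1_weight hU.
pose Ca a := (1 + `|a|) * norm1 (U a) * M.
have Ca0 a : 0 <= Ca a by rewrite !mulr_ge0 ?norm1_ge0 ?addr_ge0.
have Fbnd a b c : norm1 (F a b c) <= (Ca a * norm1 (U b)) * ((1 + `|c|) * norm1 (U c)).
  rewrite /F; apply: le_trans (norm1M _ _) _; rewrite norm1R normr_id.
  have h1 : `|a - c| <= (1 + `|a|) * (1 + `|c|).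
    have := abs_weight a (a - c).
    by rewrite opprB addrCA subrr addr0.
  have h2 : norm1 (U a * U b * (U c)^*%C * (U (a + b - c))^*%C) <=
      norm1 (U a) * norm1 (U b) * norm1 (U c) * M.
    apply: le_trans (norm1M _ _) _; apply: ler_pM; rewrite ?norm1_ge0// ?norm1J//.
    apply: le_trans (norm1M _ _) _; rewrite norm1J; apply: ler_wpM2r; rewrite ?norm1_ge0//.
    exact: norm1M.
  apply: le_trans (ler_pM (normr_ge0 _) (norm1_ge0 _) h1 h2) _.
  by rewrite le_eqVlt; apply/orP; left; apply/eqP; rewrite /Ca; ring.
have m1 : measurable_fun setT (fun z : R * R => z.1) by exact: measurable_fst.
have m2 : measurable_fun setT (fun z : R * R => z.2) by exact: measurable_snd.
have mF a : cmeasurable (fun z : R * R => F a z.1 z.2).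
  apply: cmeasurableM.
    apply: cmeasurableR; apply: measurableT_comp => //; exact: measurable_funB.
  apply: cmeasurableM; last first.
    apply: cmeasurableJ; apply: (cmeasurable_comp mU); apply: measurable_funB => //.
    exact: measurable_funD.
  apply: cmeasurableM; last exact: (cmeasurableJ (cmeasurable_comp mU m2)).
  by apply: cmeasurableM; [exact: cmeasurable_cst|exact: (cmeasurable_comp mU m1)].
have F1 a b : cintegrable (F a b).
  apply: (cintegrable_dom (g := fun c => (Ca a * norm1 (U b)) * ((1 + `|c|) * norm1 (U c)))).
  - apply: (cmeasurable_comp (mF a) (h := fun c => (b, c))).
    exact: measurable_fun_pair.
  - exact: L1Zl.
  - by move=> c; exact: Fbnd.
have Fub a := cint_fubini (mF a) (L1pair_prod (L1Zl (Ca a) (L1_norm1 Ui)) L)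
  (fun z => Fbnd a z.1 z.2).
pose K (l : R) : R[i] := s2pi%:C * W l.
have mK : cmeasurable K.
  by apply: cmeasurableM; [exact: cmeasurable_cst|exact: cmeasurable_ifourier].
have KM l : norm1 (K l) <= s2pi * (s2pi^-1 * (2 * rint (fun l => norm1 (w l)))).
  rewrite (le_trans (norm1M _ _))// norm1R ger0_norm ?sqrtr_ge0//.
  by rewrite ler_wpM2l ?sqrtr_ge0.
(* For fixed [a] and [c] the integral over [b] is an autocorrelation. *)
have inner a c : cint (fun b => F a b c) = `|a - c|%:C * (U a * (U c)^*%C) * K (a - c).
  have [ci ce] := autocorrelation (a - c).
  rewrite /K -ce -(cintZ _ ci); apply: cint_eq => b; rewrite /F addrAC.
  by ring.
(* After exchanging [b] and [c], substitute [c = a - l]. *)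
have e2 a : cint (fun b => cint (F a b)) =
    cint (fun l => (`|l|%:C * K l) * (U a * (U (a - l))^*%C)).
  have [_ g2 ->] := Fub a.
  rewrite -(cint_reflect a g2); apply: cint_eq => l.
  rewrite inner opprB addrCA subrr addr0; ring.
have [H1 H2 H3] := autocorrelation_fubini mK KM.
have F3 : cintegrable3 F.
  split; [exact: F1|by move=> a; have [g1 _ _] := Fub a; exact: g1|].
  by rewrite (funext e2); exact: H1.
split; first exact: F3.
have outer k l : cint (fun a => (`|l|%:C * k l) * (U a * (U (a - l))^*%C)) =
    (`|l|%:C * k l) * K (- l).
  have [ci ce] := autocorrelation (- l).
  rewrite /K -ce -(cintZ _ ci); apply: cint_eq => a.
  by rewrite [- l + a]addrC.
pose f l := `|l|%:C * fourier w l.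
have fi : cintegrable f.
  have [_ h _] := @autocorrelation_fubini (fun=> 1) (norm1 1) (cmeasurable_cst _) (fun _ => lexx _).
  rewrite (funext (outer (fun=> 1))) in h.
  have fE l : f l = (s2pi^-1)%:C * ((`|l|%:C * 1) * K (- l)).
    transitivity (((s2pi^-1)%:C * s2pi%:C) * f l).
      by rewrite sqrt2piVK; exact: (esym (mul1r _)).
    rewrite /f fourier_ifourier -/W /K; ring.
  by rewrite (funext fE); exact: (cintegrableZ _ h).
have [q1 q2 q3] := ifourier_pairing0 fi wi.
rewrite -[RHS]/((2 * pi)%:C * cint (fun x => w x * ifourier f x)) -q3.
transitivity (cint (fun l => (`|l|%:C * K l) * K (- l))).
  apply: (etrans (congr1 cint (funext e2))).
  by apply: (etrans H3); apply: cint_eq => l; exact: outer.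
rewrite -(cintZ _ q1) -sqrt2pi_sq; apply: cint_eq => l.
rewrite /f /K fourier_ifourier -/W; ring.
Qed.

End Nonlocal.

(** * The quadratic part *)

Section Quadratic.
Context {R : realType}.
Implicit Types (g gamma eps : R) (U : R -> R[i]).

Lemma measurable_sgr : measurable_fun setT (@Num.sg R).
Proof.
rewrite (_ : @Num.sg R = fun x => if 0 < x then 1 else if x < 0 then - 1 else 0).
  apply: measurable_fun_ifT => //; first exact: measurable_fun_ltr.
  by apply: measurable_fun_ifT => //; exact: measurable_fun_ltr.
apply/funext => x.
by have [x0|x0|x0] := ltgtP 0 x; [rewrite gtr0_sg|rewrite ltr0_sg|rewrite -x0 sgr0].
Qed.

Lemma measurable_Omega g gamma : measurable_fun setT (Omega g gamma).
Proof.
apply: measurable_funD.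
  by apply: measurable_funM => //; exact: measurable_sgr.
apply: (measurableT_comp (continuous_measurable_fun (@sqrt_continuous R))).
apply: measurable_funD => //; apply: measurable_funM => //.
Qed.

Lemma Omega_bound g gamma k : 0 <= g ->
  `|Omega g gamma k| <= `|gamma / 2| + (1 + gamma ^+ 2 / 4) + g * `|k|.
Proof.
move=> g0; rewrite /Omega (le_trans (ler_normD _ _))// -addrA.
apply: lerD.
  rewrite normrM ler_piMr// normr_sg.
  by case: (k != 0) => //=; rewrite ler01.
rewrite ger0_norm ?sqrtr_ge0// /omega -addrA.
set t := gamma ^+ 2 / 4 + g * `|k|.
have t0 : 0 <= t by apply: addr_ge0; [apply: divr_ge0 => //; exact: sqr_ge0|exact: mulr_ge0].
rewrite -/t -[X in _ <= 1 + X](sqr_sqrtr t0).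
have s0 := sqrtr_ge0 t.
by nra.
Qed.

(** The quadratic part in the slow variable: the substitution
    [k = k0 + eps * l] produces the factor [eps]. *)
Lemma H2_modulated g gamma (k0 : R) eps U : 0 <= g -> 0 < eps -> regular_profile U ->
  (H2 g gamma (modulated k0 eps U))%:C =
  eps%:C * cint (fun x => (ifourier U x)^*%C *
    multiplier (fun l => Omega g gamma (k0 + eps * l)) (ifourier U) x).
Proof.
move=> g0 e0 hU.
have e1 : eps^-1 != 0 by rewrite invr_eq0 gt_eqF.
have e2 : `|eps^-1| = eps^-1 by rewrite gtr0_norm ?invr_gt0.
have e3 : eps / eps = 1 by rewrite divff ?gt_eqF.
pose m l := Omega g gamma (k0 + eps * l).
have mm : measurable_fun setT m.
  apply: (measurableT_comp (measurable_Omega g gamma)).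
  by apply: measurable_funD => //; apply: measurable_funM.
pose C0 := `|gamma / 2| + (1 + gamma ^+ 2 / 4) + g * `|k0|.
have C00 : 0 <= C0.
  apply: addr_ge0; last exact: mulr_ge0.
  by apply: addr_ge0 => //; apply: addr_ge0 => //; apply: divr_ge0 => //; exact: sqr_ge0.
have ge0 : 0 <= g * eps by rewrite mulr_ge0// ltW.
have mb l : `|m l| <= (C0 + g * eps) * (1 + `|l|).
  apply: le_trans (Omega_bound _ _ g0) _.
  have h : g * `|k0 + eps * l| <= g * (`|k0| + eps * `|l|).
    by rewrite ler_wpM2l// (le_trans (ler_normD _ _))// normrM (gtr0_norm e0).
  have h1 : 0 <= C0 * `|l| by rewrite mulr_ge0.
  move: h h1; rewrite /C0; set a := `|gamma / 2| + _; set b := `|k0 + _| => h h1.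
  by nra.
have mUi := cintegrable_weighted hU mm mb.
have ui := cintegrable_ifourier_profile hU.
have [h1 h2 h3] := ifourier_pairing0 mUi (cintegrableJ ui).
(* The quadratic energy density in the slow frequency variable. *)
pose h l := m l * cabs (U l) ^+ 2.
have hE l : (m l)%:C * U l * ifourier (fun x => (ifourier U x)^*%C) l = (h l)%:C.
  rewrite -(conj_profile hU) /h sqr_cabs; case: (U l) => a b; simpc.
  by congr (_ +i* _) => /=; ring.
rewrite /multiplier (fourier_ifourier_profile hU) -[X in _ = _ * X]h3 (cint_eq hE) cintR.
have hi : L1 h.
  exact: (proj1 (eq_ind _ cintegrable h1 _ (funext hE))).
rewrite -[RHS]rmorphM; congr (_%:C).
rewrite (rint_affine (- k0 / eps) e1 hi) e2 mulrA e3 mul1r; apply: rint_eq => k.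
rewrite /h /m /modulated (_ : eps^-1 * k + - k0 / eps = (k - k0) / eps); last by ring.
by congr (Omega _ _ _ * _); field; rewrite gt_eqF.
Qed.

End Quadratic.

(** * The reduced Hamiltonian *)

Lemma quartic_int_lin (R : realType) (U : R -> R[i]) (B D : R) :
  regular_profile U ->
  quartic_int (fun l1 l2 l3 => B * (l2 + l3) - D * `|l1 - l3|) U =
  B%:C * quartic_int (fun l1 l2 l3 => l2 + l3) U
  - D%:C * quartic_int (fun l1 l2 l3 => `|l1 - l3|) U.
Proof.
move=> hU.
have [a1 _] := quartic_int_add hU; have [b1 _] := quartic_int_abs hU.
have [c1 c2] := cintegrable3Z B%:C a1; have [d1 d2] := cintegrable3Z (- D%:C) b1.
have [_ s2] := cintegrable3D c1 d1.
rewrite c2 d2 mulNr in s2.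
apply: etrans s2; congr cint3; apply: eq_fun3 => a b c.
by rewrite rmorphB !rmorphM /=; ring.
Qed.

(** Matching of the coefficients. Only [p = pi] has to be nonzero: the other
    denominators occur identically on both sides. *)
Lemma hamiltonian_coefficients (R : realType) (p h2 h4 e N o O d b M S I4 I3 : R) (J : R[i]) :
  p != 0 ->
  (h2 + h4)%:C - (h2%:C + (e ^+ 3 * (N / (4 * o * O * d)) * I4)%:C
    + (e ^+ 4 * (b / 2) * I3)%:C - (e ^+ 4 * (M / (2 * S)))%:C * J) =
  h4%:C - ((e ^+ 3 * (N / (8 * p * o * O * d)))%:C * (2 * p * I4)%:C
    + (e ^+ 4)%:C * ((b / (8 * p))%:C * (4 * p * I3)%:C
    - (M / (4 * p * S))%:C * ((2 * p)%:C * J))).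
Proof.
move=> p0.
have -> : e ^+ 3 * (N / (4 * o * O * d)) * I4 =
    (e ^+ 3 * (N / (8 * p * o * O * d))) * (2 * p * I4).
  by rewrite !invfM; move: o^-1 O^-1 d^-1 => x y z; field.
have -> : e ^+ 4 * (b / 2) * I3 = e ^+ 4 * (b / (8 * p)) * (4 * p * I3) by field.
have -> : e ^+ 4 * (M / (2 * S)) = e ^+ 4 * (M / (4 * p * S)) * (2 * p).
  by rewrite !invfM; move: S^-1 => x; field.
move: (N / _) (b / _) (M / _) => x y z.
by rewrite !rmorphD !rmorphM /=; ring.
Qed.

Theorem lemma6p1 (R : realType) (g gamma k0 : R) (hg : 0 < g) (hk0 : 0 < k0)
  (U : R -> R[i]) (hU : regular_profile U)
  (H4 : (R -> R[i]) -> R)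
  (hH4 :
    let o0 := omega g gamma k0 in
    let O0 := Omega g gamma k0 in
    is_O5 (fun eps : R =>
      (H4 (modulated k0 eps U))%:C -
      ((eps ^+ 3 * (k0 ^+ 3 * (o0 - gamma) * (gamma ^+ 2 + 4 * o0 ^+ 2)
                    / (8 * pi * o0 * O0 * (2 * o0 - gamma))))%:C
         * quartic_int (fun _ _ _ => 1) U
       + (eps ^+ 4)%:C
         * quartic_int (fun l1 l2 l3 =>
             beta g gamma k0 / (8 * pi) * (l2 + l3)
             - k0 ^+ 2 * o0 ^+ 2 / (4 * pi * O0 ^+ 2) * `|l1 - l3|) U))) :
  let o0 := omega g gamma k0 in
  let O0 := Omega g gamma k0 in
  let u := ifourier U in
  is_O5 (fun eps : R =>
    (reduced_H g gamma H4 (modulated k0 eps U))%:C -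
    (eps%:C * cint (fun X =>
        (u X)^*%C * multiplier (fun l => Omega g gamma (k0 + eps * l)) u X)
     + (eps ^+ 3 * (k0 ^+ 3 * (o0 - gamma) * (gamma ^+ 2 + 4 * o0 ^+ 2)
                    / (4 * o0 * O0 * (2 * o0 - gamma)))
        * rint (fun X => cabs (u X) ^+ 4))%:C
     + (eps ^+ 4 * (beta g gamma k0 / 2)
        * rint (fun X => cabs (u X) ^+ 2 * complex.Im ((u X)^*%C * cderive u X)))%:C
     - (eps ^+ 4 * (k0 ^+ 2 * o0 ^+ 2 / (2 * O0 ^+ 2)))%:C
       * cint (fun X => (cabs (u X) ^+ 2)%:C
           * multiplier (fun l => `|l|) (fun Y => (cabs (u Y) ^+ 2)%:C) X))).
Proof.
move=> o0 O0 u.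
case: hH4 => C HC; exists C.
move: HC (nbhs_right_gt (0 : R)); apply: filterS2 => eps Heps e0.
apply: le_trans Heps; rewrite le_eqVlt; apply/orP; left; apply/eqP; congr cabs.
have p0 : pi != 0 :> R by rewrite gt_eqF ?pi_gt0.
have [_ Q1] := quartic_int_const hU.
have [_ Qa] := quartic_int_add hU.
have [_ Qd] := quartic_int_abs hU.
rewrite (quartic_int_lin _ _ hU) Q1 Qa Qd -(H2_modulated _ _ (ltW hg) e0 hU).
exact: hamiltonian_coefficients p0.
Qed.
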